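(* Let $x_1,x_2,\dots\in\mathbb R^p$ be covariate vectors and let $Y_1,Y_2,\dots$ be independent with $Y_i\in\{0,1\}$ and $\Pr\{Y_i=1\mid x_i\}=q_i=\exp(\beta_0'x_i)/\{1+\exp(\beta_0'x_i)\}$ for some $\beta_0\in\mathbb R^p$. Let $\hat\beta_n$ be the maximum likelihood estimator and $J_n=\sum_{i\le n}q_i(1-q_i)x_ix_i'$ (assumed invertible). Assume that the sequence $\lambda_n=\max_{i\le n}|J_n^{-1/2}x_i|$ is bounded, and that $$N_n(\delta)=\sum_{i\le n}q_i(1-q_i)\,x_i'J_n^{-1}x_i\,I\{|J_n^{-1/2}x_i|\ge\delta\}\to0\quad\text{for each }\delta>0.$$ Then $J_n^{1/2}(\hat\beta_n-\beta_0)\to_d N_p\{0,I_p\}$.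
   Context: $J_n^{1/2}$ is the symmetric square root of $J_n$ and $J_n^{-1/2}$ its inverse. $N_p\{0,I_p\}$ is the standard $p$-variate normal distribution. *)

(* Defs.v *)
From HB Require Import structures.
From mathcomp Require Import all_boot all_order all_algebra.
From mathcomp Require Import all_classical all_reals all_analysis.
Set Implicit Arguments. Unset Strict Implicit. Unset Printing Implicit Defensive.
Import Order.TTheory GRing.Theory Num.Theory.
Import numFieldNormedType.Exports.
Local Open Scope classical_set_scope.
Local Open Scope ring_scope.

Section defs.
Variable R : realType.

Definition dotv (p : nat) (u v : 'cV[R]_p) : R := (u^T *m v) ord0 ord0.

Definition eucl_norm (p : nat) (v : 'cV[R]_p) : R :=
  Num.sqrt (\sum_(i < p) v i ord0 ^+ 2).

Definition logistic (t : R) : R := expR t / (1 + expR t).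

Definition loglik (p : nat) (x : nat -> 'cV[R]_p) (n : nat)
    (beta : 'cV[R]_p) (y : nat -> R) : R :=
  \sum_(i < n) (y i * ln (logistic (dotv beta (x i)))
                + (1 - y i) * ln (1 - logistic (dotv beta (x i)))).

Definition is_sym_sqrt (p : nat) (S A : 'M[R]_p) : Prop :=
  S^T = S /\ (forall v : 'cV[R]_p, 0 <= dotv v (S *m v)) /\ S *m S = A.

Definition mutually_independent_rv d (T : measurableType d)
    (P : probability T R) (Y : nat -> T -> R) : Prop :=
  forall (s : seq nat) (B : nat -> set R), uniq s ->
    (forall i, measurable (B i)) ->
    P [set w | forall i, i \in s -> B i (Y i w)] =
    (\prod_(i <- s) P (Y i @^-1` B i))%E.

Fixpoint gauss_iter (k : nat) (g : (nat -> R) -> R) : (nat -> R) -> R :=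
  match k with
  | 0 => g
  | k'.+1 => fun z =>
      Rintegral (normal_prob 0 1) setT
        (fun t => gauss_iter k' g (fun j => if j == k' then t else z j))
  end.

(** expectation of f(Z) for Z ~ N_p{0, I_p} (density = product of the
    N(0,1) densities, integrated coordinatewise) *)
Definition std_normal_expect (p : nat) (f : 'cV[R]_p -> R) : R :=
  gauss_iter p (fun z => f (\col_(i < p) z i)) (fun _ => 0).

Definition cvg_dist_std_normal d (T : measurableType d) (P : probability T R)
    (p : nat) (Z : nat -> T -> 'cV[R]_p) : Prop :=
  forall f : 'cV[R]_p -> R, continuous f ->
    (exists M : R, forall z, `|f z| <= M) ->
    (fun n => fine ('E_P[f \o Z n])%E) @ \oo --> std_normal_expect f.

End defs.

(* Main.v *)
(** With [v_i = J_n^{-1/2} x_i], the log-likelihood at [beta_0 + J_n^{-1/2} h]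
    differs from that at [beta_0] by [h'U_n - |h|^2/2] up to an error of order
    [|h|^3 sum_i q_i (1 - q_i) |v_i|^3], where
    [U_n = sum_i (Y_i - q_i) v_i]; the cubic sum is at most
    [delta p + lambda_n N_n(delta)], hence tends to [0].  As the log-likelihood
    is concave, once it is strictly smaller on a sphere around [U_n] than at
    [U_n] the maximiser exists and lies inside that sphere, so
    [J_n^{1/2} (betahat_n - beta_0)] is close to [U_n] whenever [U_n] is bounded.

    The limit law of [U_n] follows from Lindeberg's argument on the functions
    [cos (theta'u + phi)], swapping one summand at a time.  A bounded continuous
    test function is replaced on a cube by a trigonometric polynomial with the
    same bound: composing the Bernstein polynomials with [u_j |-> sin (u_j / L)]
    gives one, and Bernstein's weights are again Bernoulli means.  The remainder
    outside the cube is absorbed by second moments. *)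

Require Import Defs.
From HB Require Import structures.
From mathcomp Require Import all_boot all_order all_algebra.
From mathcomp Require Import all_classical all_reals all_analysis.
From mathcomp Require Import measurable_realfun.
From mathcomp Require Import ring lra.
Import Order.TTheory GRing.Theory Num.Theory.
Import numFieldNormedType.Exports.
Local Open Scope classical_set_scope.
Local Open Scope ring_scope.

(** * Scalar estimates *)

Section scalar_estimates.
Variable R : realType.
Set Implicit Arguments. Unset Strict Implicit.
Implicit Types a b c f g q s t x y K : R.

(** The estimator is controlled only where the localisation works, and the Gaussian expectation is
    an iterated integral whose inner integrals are known only approximately. Both obstacles are met
    by one kind of pointwise bound: the distance to a trigonometric polynomial is at most e + C
    |u|^2. Such a bound survives integrating one coordinate after another as well as averaging over
    the responses, and the mean of a trigonometric polynomial is explicit under the normal law and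
    nearly explicit under the responses. Expectations over the responses are turned into finite
    weighted sums over {0,1}-outcomes, so that Lindeberg's swapping becomes an induction on the
    number of summands. The Gaussian variable swapped in never appears: it is represented by the
    factor exp(- q (1 - q) s^2 / 2) that it contributes to the mean of a cosine. Every error that
    varies with n is a multiple of sum_i q_i (1 - q_i) |v_i|^3 with a factor free of n. Hence the
    cube, the polynomial and the localisation radius can all be fixed before n. *)

Lemma deriv_ge0_le {f df : R -> R} {a t} : a <= t ->
  (forall x, a <= x <= t -> is_derive x 1 f (df x)) ->
  (forall x, a <= x <= t -> 0 <= df x) -> f a <= f t.
Proof.
move=> at_ hf hdf.
have dI x : x \in `]a, t[ -> is_derive x 1 f (df x).
  by rewrite in_itv/= => /andP[ax xt]; apply: hf; rewrite !ltW.
have [|c] := @MVT_segment _ f df a t at_ dI.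
  apply: derivable_within_continuous => x; rewrite in_itv/= => xat.
  by have [] := hf x xat.
rewrite in_itv/= => cat e.
by rewrite -subr_ge0 e mulr_ge0 ?subr_ge0// hdf.
Qed.

(** Bottom rung of a ladder of Taylor bounds: each of the next three follows from the one before it,
    which gives the sign of the derivative of the difference. *)
Lemma sin_le_id x : 0 <= x -> sin x <= x.
Proof.
move=> x0.
suff : 0 - sin 0 <= x - sin x by rewrite sin0 subr0 subr_ge0.
pose F t : R := t - sin t; rewrite -/(F 0) -/(F x).
apply: (@deriv_ge0_le F (fun t => 1 - cos t) 0 x) => //.
Qed.

Lemma cos_ge_quad x : 0 <= x -> 1 - x ^+ 2 / 2 <= cos x.
Proof.
move=> x0; pose F t : R := cos t + t ^+ 2 / 2.
suff : F 0 <= F x by rewrite /F cos0; lra.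
apply: (@deriv_ge0_le F (fun t => t - sin t) 0 x) => //.
  by move=> y _; apply: is_derive_eq; rewrite /GRing.scale/=; field.
by move=> y /andP[y0 _]; rewrite subr_ge0 sin_le_id.
Qed.

Lemma sin_ge_cubic x : 0 <= x -> x - x ^+ 3 / 6 <= sin x.
Proof.
move=> x0; pose F t : R := sin t - t + t ^+ 3 / 6.
suff : F 0 <= F x by rewrite /F sin0; lra.
apply: (@deriv_ge0_le F (fun t => cos t - 1 + t ^+ 2 / 2) 0 x) => //.
  by move=> y _; apply: is_derive_eq; rewrite /GRing.scale/=; field.
by move=> y /andP[y0 _]; have := cos_ge_quad y0; lra.
Qed.

Lemma cos_le_quartic x : 0 <= x -> cos x <= 1 - x ^+ 2 / 2 + x ^+ 4 / 24.
Proof.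
move=> x0; pose F t : R := t ^+ 4 / 24 - t ^+ 2 / 2 - cos t.
suff : F 0 <= F x by rewrite /F cos0; lra.
apply: (@deriv_ge0_le F (fun t => t ^+ 3 / 6 - t + sin t) 0 x) => //.
  by move=> y _; apply: is_derive_eq; rewrite /GRing.scale/=; field.
by move=> y /andP[y0 _]; have := sin_ge_cubic y0; lra.
Qed.

Lemma sin_cubic x : `|sin x - x| <= `|x| ^+ 3 / 6.
Proof.
wlog x0 : x / 0 <= x.
  move=> H; have [/H//|xl] := leP 0 x.
  have := H (- x); rewrite oppr_ge0 sinN normrN -opprD normrN; apply.
  exact: ltW.
rewrite (ger0_norm x0) ler_norml.
have := sin_ge_cubic x0; have := sin_le_id x0.
have := exprn_ge0 3 x0; lra.
Qed.

Lemma cos_quartic x : `|cos x - 1 + x ^+ 2 / 2| <= x ^+ 4 / 24.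
Proof.
wlog x0 : x / 0 <= x.
  move=> H; have [/H//|xl] := leP 0 x.
  have := H (- x); rewrite oppr_ge0 cosN sqrrN.
  by rewrite (exprNn x 4) -signr_odd/= expr0 mul1r; apply; exact: ltW.
rewrite ler_norml; have := cos_le_quartic x0; have := cos_ge_quad x0.
have := exprn_ge0 4 x0; lra.
Qed.

Lemma expRN_quad x : 0 <= x -> `|expR (- x) - 1 + x| <= x ^+ 2 / 2.
Proof.
move=> x0; pose F t : R := t ^+ 2 / 2 - t - expR (- t).
have : F 0 <= F x.
  apply: (@deriv_ge0_le F (fun t => t - 1 + expR (- t)) 0 x) => //.
    by move=> y _; apply: is_derive_eq; rewrite /GRing.scale/=; field.
  by move=> y _; have := expR_ge1Dx (- y); lra.
rewrite /F oppr0 expR0; have := expR_ge1Dx (- x).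
rewrite ler_norml; have := sqr_ge0 x; lra.
Qed.

(** One Lindeberg swap. For X Bernoulli of mean q and G standard normal, E cos(f + (X - q) s) is
    compared with E cos(f + sigma s G), where sigma^2 = q (1 - q). The first two moments agree, so
    only the cubic remainder of the sine and quartic remainders are left. *)
Lemma bernoulli_cf_approx q f s : 0 <= q <= 1 ->
  `|q * cos (f + (1 - q) * s) + (1 - q) * cos (f + (0 - q) * s)
     - expR (- (q * (1 - q) * s ^+ 2 / 2)) * cos f|
  <= q * (1 - q) * s ^+ 2 * (`|s| + s ^+ 2).
Proof.
move=> /andP[q0 q1].
set r := 1 - q; have r0 : 0 <= r by rewrite subr_ge0.
have r1 : r <= 1 by rewrite /r; lra.
have qr : q + r = 1 by rewrite /r; ring.
have e1 := cos_quartic (r * s); have e2 := cos_quartic (- q * s).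
have e3 := sin_cubic (r * s); have e4 := sin_cubic (- q * s).
have c0 : 0 <= q * r by rewrite mulr_ge0.
have e5 : `|expR (- (q * r * s ^+ 2 / 2)) - 1 + q * r * s ^+ 2 / 2|
    <= (q * r * s ^+ 2 / 2) ^+ 2 / 2.
  by apply: expRN_quad; rewrite divr_ge0// mulr_ge0 ?sqr_ge0.
rewrite sub0r !cosD.
(* The linear terms cancel because q r - r q = 0, the quadratic ones because q r^2 + r q^2 = q r. *)
have -> : q * (cos f * cos (r * s) - sin f * sin (r * s)) +
   r * (cos f * cos (- q * s) - sin f * sin (- q * s)) -
   expR (- (q * r * s ^+ 2 / 2)) * cos f =
   cos f * (q * (cos (r * s) - 1 + (r * s) ^+ 2 / 2)
     + r * (cos (- q * s) - 1 + (- q * s) ^+ 2 / 2)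
     - (expR (- (q * r * s ^+ 2 / 2)) - 1 + q * r * s ^+ 2 / 2))
   - sin f * (q * (sin (r * s) - r * s) + r * (sin (- q * s) - (- q * s))).
  have -> : q = 1 - r by rewrite -qr; ring.
  by field.
apply: le_trans (ler_normB _ _) _; rewrite !normrM.
have cf : `|cos f| <= 1 by rewrite ler_norml cos_geN1 cos_le1.
have sf : `|sin f| <= 1 by rewrite ler_norml sin_geN1 sin_le1.
have qle : q ^+ 2 <= 1 by rewrite expr_le1.
have rle : r ^+ 2 <= 1 by rewrite expr_le1.
have qle3 : q ^+ 3 <= 1 by rewrite expr_le1.
have rle3 : r ^+ 3 <= 1 by rewrite expr_le1.
have s4 : 0 <= s ^+ 4 by rewrite exprn_even_ge0.
have S3 : 0 <= `|s| ^+ 3 by rewrite exprn_ge0.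
have A : `|q * (cos (r * s) - 1 + (r * s) ^+ 2 / 2)
     + r * (cos (- q * s) - 1 + (- q * s) ^+ 2 / 2)
     - (expR (- (q * r * s ^+ 2 / 2)) - 1 + q * r * s ^+ 2 / 2)|
     <= q * r * s ^+ 4.
  apply: le_trans (ler_normB _ _) _.
  apply: (@le_trans _ _ (q * ((r * s) ^+ 4 / 24) + r * ((- q * s) ^+ 4 / 24)
     + (q * r * s ^+ 2 / 2) ^+ 2 / 2)).
    apply: lerD => //; apply: le_trans (ler_normD _ _) _.
    by rewrite !normrM (ger0_norm q0) (ger0_norm r0); apply: lerD; apply: ler_wpM2l.
  have -> : q * ((r * s) ^+ 4 / 24) + r * ((- q * s) ^+ 4 / 24)
     + (q * r * s ^+ 2 / 2) ^+ 2 / 2 =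
     q * r * s ^+ 4 * (r ^+ 3 / 24 + q ^+ 3 / 24 + q * r / 8) by field.
  rewrite -[leRHS]mulr1; apply: ler_wpM2l; first by rewrite mulr_ge0.
  have : q * r <= 1 by rewrite mulr_ile1.
  lra.
have B : `|q * (sin (r * s) - r * s) + r * (sin (- q * s) - (- q * s))|
     <= q * r * `|s| ^+ 3.
  apply: (@le_trans _ _ (q * ((r * `|s|) ^+ 3 / 6) + r * ((q * `|s|) ^+ 3 / 6))).
    apply: le_trans (ler_normD _ _) _.
    rewrite !normrM (ger0_norm q0) (ger0_norm r0).
    move: e3 e4; rewrite !normrM normrN (ger0_norm q0) (ger0_norm r0) => e3 e4.
    by apply: lerD; apply: ler_wpM2l.
  have -> : q * ((r * `|s|) ^+ 3 / 6) + r * ((q * `|s|) ^+ 3 / 6) =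
     q * r * `|s| ^+ 3 * (r ^+ 2 / 6 + q ^+ 2 / 6) by field.
  rewrite -[leRHS]mulr1; apply: ler_wpM2l; first by rewrite mulr_ge0.
  lra.
have s2 : s ^+ 2 = `|s| ^+ 2 by rewrite real_normK ?num_real.
have -> : q * r * s ^+ 2 * (`|s| + s ^+ 2) = q * r * s ^+ 4 + q * r * `|s| ^+ 3.
  have -> : s ^+ 4 = `|s| ^+ 4 by rewrite -[4%N]/(2 * 2)%N !exprM s2.
  by rewrite s2; ring.
apply: lerD.
  by apply: le_trans A; rewrite ler_piMl.
by apply: le_trans B; rewrite ler_piMl.
Qed.

Lemma bernoulli_mgf_gt0 q t : 0 <= q <= 1 -> 0 < 1 - q + q * expR t.
Proof.
move=> /andP[q0 q1]; have [->|qn] := eqVneq q 0.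
  by rewrite mul0r; lra.
have : 0 < q * expR t by rewrite mulr_gt0 ?expR_gt0// lt_neqAle eq_sym qn.
lra.
Qed.

Lemma expR_mul_le_bernoulli_mgf q t : 0 <= q <= 1 ->
  expR (q * t) <= 1 - q + q * expR t.
Proof.
move=> q01.
have := convex_expR (Itv01 (proj1 (andP q01)) (proj2 (andP q01))) t 0.
rewrite !convRE/= !mulr0 addr0 expR0 mulr1.
by rewrite addrC.
Qed.

(** Exponential tilting: relative to the point s, the moment generating function at t is that of a
    Bernoulli variable with tilted mean [Q], taken at t - s. Jensen's inequality for the tilted
    variable is then the tangent inequality. *)
Lemma ln_bernoulli_mgf_tangent q s t : 0 <= q <= 1 ->
  ln (1 - q + q * expR s) + q * expR s / (1 - q + q * expR s) * (t - s)
  <= ln (1 - q + q * expR t).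
Proof.
move=> q01; have [q0 q1] := andP q01.
have s0 := bernoulli_mgf_gt0 s q01; have t0 := bernoulli_mgf_gt0 t q01.
set D := 1 - q + q * expR s in s0 *.
set Q := q * expR s / D.
have Q01 : 0 <= Q <= 1.
  rewrite divr_ge0 ?mulr_ge0 ?expR_ge0 ?(ltW s0)//=.
  by rewrite ler_pdivrMr// mul1r /D; lra.
have H := expR_mul_le_bernoulli_mgf (t - s) Q01.
have E : 1 - q + q * expR t = D * (1 - Q + Q * expR (t - s)).
  have : D * Q = q * expR s by rewrite /Q mulrC divfK// gt_eqF.
  move: (Q) => Q' Q0.
  rewrite expRB mulrDr mulrBr mulr1 (mulrA D) Q0 -mulrA.
  by rewrite (mulrC (expR s)) divfK ?gt_eqF ?expR_gt0// /D; ring.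
rewrite E lnM ?posrE ?bernoulli_mgf_gt0// lerD2l.
rewrite -[leLHS]expRK ler_ln ?posrE ?expR_gt0 ?bernoulli_mgf_gt0//.
Qed.

(** The derivative of the cumulant function is the tilted mean [p], and that of [p] is the tilted
    variance c e^x / D^2. For x >= 0 one has 1 <= D <= e^x, which keeps this variance between c
    e^(-x) and c e^x, hence within c E x of c; integrating twice from 0 gives the claim. *)
Lemma ln_bernoulli_mgf_approx_ge0 q t K : 0 <= q <= 1 -> 0 <= t <= K ->
  `|ln (1 - q + q * expR t) - q * t - q * (1 - q) * t ^+ 2 / 2|
  <= q * (1 - q) * expR K * t ^+ 3.
Proof.
move=> q01 /andP[t0 tK]; have [q0 q1] := andP q01.
pose D x := 1 - q + q * expR x; pose p x := q * expR x / D x.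
have D0 x : 0 < D x by exact: bernoulli_mgf_gt0.
have Dn x : D x != 0 by rewrite gt_eqF.
have dD x : is_derive x 1 D (q * expR x).
  by apply: is_derive_eq; rewrite /GRing.scale/=; ring.
have dF x : is_derive x 1 (fun y => ln (D y)) (p x).
  have := is_derive1_comp (is_derive1_ln (D0 x)) (dD x).
  by rewrite /p mulrC.
have c0 : 0 <= q * (1 - q) by rewrite mulr_ge0// subr_ge0.
set c := q * (1 - q) in c0 *.
set E := expR K.
have dp x : is_derive x 1 p (c * expR x / D x ^+ 2).
  have dV : is_derive x 1 (fun y => (D y)^-1) (- (D x) ^- 2 * (q * expR x)).
    exact: is_deriveV.
  rewrite /p; apply: is_derive_eq.
  rewrite /GRing.scale/= /c.
  by move: (Dn x); rewrite /D => Dx; field.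
clearbody c.
have D1 x : 0 <= x -> 1 <= D x.
  move=> x0; have : 1 <= expR x by rewrite -expR0 ler_expR.
  rewrite /D => h; have : 0 <= q * (expR x - 1) by rewrite mulr_ge0// subr_ge0.
  lra.
have De x : 0 <= x -> D x <= expR x.
  move=> x0; have h : 1 <= expR x by rewrite -expR0 ler_expR.
  have : 0 <= (1 - q) * (expR x - 1) by rewrite mulr_ge0// subr_ge0.
  rewrite /D; lra.
have up x : 0 <= x <= t -> c * expR x / D x ^+ 2 <= c + c * E * x.
  move=> /andP[x0 xt].
  apply: (@le_trans _ _ (c * expR x)).
    rewrite ler_pdivrMr ?exprn_gt0// ler_peMr// ?mulr_ge0 ?expR_ge0//.
    by rewrite expr_ge1 ?D1// ltW.
  rewrite -{2}[c]mulr1 -mulrA -mulrDr ler_wpM2l//.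
  have h1 := expR_ge1Dx (- x); rewrite expRN in h1.
  have h2 : expR x <= E by rewrite ler_expR (le_trans xt).
  have h3 : (1 - x) * expR x <= 1.
    by rewrite -ler_pdivlMr ?expR_gt0// mul1r.
  have : 0 <= (E - expR x) * x by rewrite mulr_ge0// subr_ge0.
  nra.
have lo x : 0 <= x <= t -> c - c * E * x <= c * expR x / D x ^+ 2.
  move=> /andP[x0 xt].
  have E1 : 1 <= E by rewrite -expR0 ler_expR (le_trans _ tK).
  apply: (@le_trans _ _ (c * expR (- x))).
    rewrite -{1}[c]mulr1 -mulrA -mulrBr ler_wpM2l//.
    have h1 := expR_ge1Dx (- x).
    have : 0 <= (E - 1) * x by rewrite mulr_ge0// subr_ge0.
    lra.
  rewrite -mulrA ler_wpM2l// ler_pdivlMr ?exprn_gt0//.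
  rewrite expRN mulrC ler_pdivrMr ?expR_gt0// -expr2.
  by apply: lerXn2r; rewrite ?nnegrE ?De ?expR_ge0// ltW.
have D00 : D 0 = 1 by rewrite /D expR0; ring.
have p0 : p 0 = q by rewrite /p D00 expR0 divr1 mulr1.
have pup x : 0 <= x <= t -> p x <= q + c * x + c * E * x ^+ 2.
  move=> /andP[x0 xt].
  pose G y : R := q + c * y + c * E * y ^+ 2 / 2 - p y.
  have : G 0 <= G x.
    apply: (@deriv_ge0_le G (fun y => c + c * E * y - c * expR y / D y ^+ 2)) => //.
      by move=> y _; apply: is_derive_eq; rewrite /GRing.scale/=; field; exact: Dn.
    by move=> y /andP[y0 yx]; rewrite subr_ge0 up// y0 (le_trans yx).
  rewrite /G p0.
  have : 0 <= c * E * x ^+ 2 by rewrite !mulr_ge0 ?expR_ge0 ?sqr_ge0.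
  lra.
have plo x : 0 <= x <= t -> q + c * x - c * E * x ^+ 2 <= p x.
  move=> /andP[x0 xt].
  pose G y : R := p y - (q + c * y - c * E * y ^+ 2 / 2).
  have : G 0 <= G x.
    apply: (@deriv_ge0_le G (fun y => c * expR y / D y ^+ 2 - (c - c * E * y))) => //.
      by move=> y _; apply: is_derive_eq; rewrite /GRing.scale/=; field; exact: Dn.
    by move=> y /andP[y0 yx]; rewrite subr_ge0 lo// y0 (le_trans yx).
  rewrite /G p0.
  have : 0 <= c * E * x ^+ 2 by rewrite !mulr_ge0 ?expR_ge0 ?sqr_ge0.
  lra.
have cE : 0 <= c * E * t ^+ 3 by rewrite !mulr_ge0 ?expR_ge0 ?exprn_ge0.
rewrite -/(D t) ler_norml; apply/andP; split.
  pose G y : R := ln (D y) - (q * y + c * y ^+ 2 / 2 - c * E * y ^+ 3 / 3).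
  have : G 0 <= G t.
    apply: (@deriv_ge0_le G (fun y => p y - (q + c * y - c * E * y ^+ 2))) => //.
      by move=> y _; apply: is_derive_eq; rewrite /GRing.scale/=; field.
    by move=> y yt; rewrite subr_ge0 plo.
  rewrite /G D00 ln1; lra.
pose G y : R := (q * y + c * y ^+ 2 / 2 + c * E * y ^+ 3 / 3) - ln (D y).
have : G 0 <= G t.
  apply: (@deriv_ge0_le G (fun y => (q + c * y + c * E * y ^+ 2) - p y)) => //.
    by move=> y _; apply: is_derive_eq; rewrite /GRing.scale/=; field.
  by move=> y yt; rewrite subr_ge0 pup.
rewrite /G D00 ln1; lra.
Qed.

(* Exchanging the two outcomes maps (q, t) to (1 - q, - t). *)
Lemma ln_bernoulli_mgf_approx q t K : 0 <= q <= 1 -> `|t| <= K ->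
  `|ln (1 - q + q * expR t) - q * t - q * (1 - q) * t ^+ 2 / 2|
  <= q * (1 - q) * expR K * `|t| ^+ 3.
Proof.
move=> q01 tK; have [t0|t0] := leP 0 t.
  rewrite (ger0_norm t0) in tK *.
  by apply: ln_bernoulli_mgf_approx_ge0; rewrite ?t0.
have r01 : 0 <= 1 - q <= 1 by lra.
rewrite (ltr0_norm t0) in tK *.
have := @ln_bernoulli_mgf_approx_ge0 (1 - q) (- t) K r01.
rewrite oppr_ge0 (ltW t0) tK => /(_ isT).
have E : 1 - q + q * expR t = expR t * (1 - (1 - q) + (1 - q) * expR (- t)).
  by rewrite expRN mulrDr mulrCA divff ?gt_eqF ?expR_gt0//; ring.
rewrite E lnM ?posrE ?expR_gt0 ?bernoulli_mgf_gt0// expRK.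
set A := ln _.
have -> : t + A - q * t - q * (1 - q) * t ^+ 2 / 2 =
  A - (1 - q) * - t - (1 - q) * (1 - (1 - q)) * (- t) ^+ 2 / 2 by field.
by have -> : (1 - q) * (1 - (1 - q)) = q * (1 - q) by ring.
Qed.

End scalar_estimates.

(** * Means over independent Bernoulli variables *)

Section bernoulli_mean.
Variable R : realType.
Set Implicit Arguments. Unset Strict Implicit.
Implicit Types (q s y z : nat -> R) (G H : (nat -> R) -> R) (n k : nat).

Definition upd y k (t : R) : nat -> R := fun j => if j == k then t else y j.

Lemma upd_same y k t : upd y k t k = t.
Proof. by rewrite /upd eqxx. Qed.

(** Coordinates n - 1, ..., 0 are averaged out and the others keep their value in [y]. The weights
    are an arbitrary sequence because three kinds occur: the response probabilities, the variable
    arguments of Bernstein polynomials, and the 0/1 responses themselves, for which the mean is an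
    evaluation. *)
Fixpoint bern_mean q n G : (nat -> R) -> R :=
  match n with
  | 0 => G
  | k.+1 => fun y => q k * bern_mean q k G (upd y k 1)
                     + (1 - q k) * bern_mean q k G (upd y k 0)
  end.

Lemma eq_bern_mean q n G H y : G =1 H -> bern_mean q n G y = bern_mean q n H y.
Proof. by move=> GH; elim: n y => [|n ih] y /=; rewrite ?GH// !ih. Qed.

Lemma bern_mean_cst q n (c : R) y : bern_mean q n (fun=> c) y = c.
Proof. by elim: n y => [//|n ih] y /=; rewrite !ih -mulrDl addrC subrK mul1r. Qed.

Lemma bern_meanD q n G H y :
  bern_mean q n (fun z => G z + H z) y = bern_mean q n G y + bern_mean q n H y.
Proof. by elim: n y => [//|n ih] y /=; rewrite !ih; ring. Qed.

Lemma bern_meanZ q n (c : R) G y :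
  bern_mean q n (fun z => c * G z) y = c * bern_mean q n G y.
Proof. by elim: n y => [//|n ih] y /=; rewrite !ih; ring. Qed.

Lemma bern_mean_sum q n (I : Type) (r : seq I) (P : pred I)
    (F : I -> (nat -> R) -> R) y :
  bern_mean q n (fun z => \sum_(i <- r | P i) F i z) y =
  \sum_(i <- r | P i) bern_mean q n (F i) y.
Proof.
elim: r => [|i r ih].
  by under eq_bern_mean do rewrite big_nil; rewrite bern_mean_cst big_nil.
rewrite big_cons -ih -bern_meanD; case: ifP => Pi.
  by apply: eq_bern_mean => z; rewrite big_cons Pi.
by apply: eq_bern_mean => z; rewrite big_cons Pi.
Qed.

Lemma le_bern_mean q n G H y : (forall i, 0 <= q i <= 1) ->
  (forall z, G z <= H z) -> bern_mean q n G y <= bern_mean q n H y.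
Proof.
move=> q01 GH; elim: n y => [//|n ih] y /=.
have /andP[q0 q1] := q01 n.
by apply: lerD; apply: ler_wpM2l; rewrite ?subr_ge0.
Qed.

Lemma ler_norm_bern_meanB q n G H (c : R) y : (forall i, 0 <= q i <= 1) ->
  (forall z, `|G z - c| <= H z) -> `|bern_mean q n G y - c| <= bern_mean q n H y.
Proof.
move=> q01 GH.
have hG : bern_mean q n G y <= c + bern_mean q n H y.
  rewrite -{1}(bern_mean_cst q n c y) -bern_meanD; apply: le_bern_mean => // z.
  by have := GH z; rewrite ler_norml; lra.
have hG' : c - bern_mean q n H y <= bern_mean q n G y.
  rewrite -{1}(bern_mean_cst q n c y) -mulN1r -bern_meanZ -bern_meanD.
  by apply: le_bern_mean => // z; have := GH z; rewrite ler_norml; lra.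
by rewrite ler_norml; lra.
Qed.

(** The coordinates from [k] on are those that [bern_mean q k] leaves alone, so such a function
    behaves as a constant under that mean. The inductions below move the last summand into a
    function of this kind. *)
Definition depends_above k G :=
  forall y z, (forall j, (k <= j)%N -> y j = z j) -> G y = G z.

Lemma depends_above_upd k G y t : depends_above k.+1 G -> G (upd y k t) = G y.
Proof. by apply=> j kj; rewrite /upd gtn_eqF. Qed.

Lemma depends_aboveD k c (a b : R) : depends_above k.+1 c ->
  depends_above k (fun y => c y + (y k - a) * b).
Proof.
move=> hc y z yz; rewrite (hc y z) ?yz// => j kj; exact/yz/ltnW.
Qed.

(** The last summand is absorbed into [c]; averaging over it kills the cross term, as it is centred,
    and leaves its variance. *)
Lemma bern_mean_sqr q n s (c : (nat -> R) -> R) y : depends_above n c ->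
  bern_mean q n (fun y => (c y + \sum_(i < n) (y i - q i) * s i) ^+ 2) y =
  c y ^+ 2 + \sum_(i < n) q i * (1 - q i) * s i ^+ 2.
Proof.
elim: n c y => [|n ih] c y hc /=; first by rewrite !big_ord0 !addr0.
have E z : (c z + \sum_(i < n.+1) (z i - q i) * s i) ^+ 2 =
  ((c z + (z n - q n) * s n) + \sum_(i < n) (z i - q i) * s i) ^+ 2.
  by rewrite big_ord_recr/= -addrA [_ + (_ - _) * _]addrC.
rewrite !(eq_bern_mean _ _ _ E) !(ih _ _ (depends_aboveD _ _ hc)).
rewrite !(depends_above_upd _ _ hc) !upd_same big_ord_recr/=.
by ring.
Qed.

(** The swaps telescope: with the last summand moved into the phase, induction swaps the earlier
    ones for both outcomes, and a single swap handles the last. The Gaussian factor [e] already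
    collected is at most 1, so errors add up without amplification. *)
Lemma bern_mean_cos q n s (c : (nat -> R) -> R) y :
  (forall i, 0 <= q i <= 1) -> depends_above n c ->
  `|bern_mean q n (fun y => cos (c y + \sum_(i < n) (y i - q i) * s i)) y
     - expR (- (\sum_(i < n) q i * (1 - q i) * s i ^+ 2) / 2) * cos (c y)|
  <= \sum_(i < n) q i * (1 - q i) * s i ^+ 2 * (`|s i| + s i ^+ 2).
Proof.
move=> q01; elim: n c y => [|n ih] c y hc /=.
  by rewrite !big_ord0 oppr0 mul0r expR0 mul1r addr0 subrr normr0.
have E z : cos (c z + \sum_(i < n.+1) (z i - q i) * s i) =
  cos ((c z + (z n - q n) * s n) + \sum_(i < n) (z i - q i) * s i).
  by rewrite big_ord_recr/= -addrA [_ + (_ - _) * _]addrC.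
rewrite !(eq_bern_mean _ _ _ E).
have h1 := ih _ (upd y n 1) (depends_aboveD (q n) (s n) hc).
have h0 := ih _ (upd y n 0) (depends_aboveD (q n) (s n) hc).
move: h1 h0; rewrite !(depends_above_upd _ _ hc).
rewrite !upd_same.
set B1 := bern_mean _ _ _ _; set B0 := bern_mean _ _ _ (upd y n 0).
set S := \sum_(i < n) _; set rho := \sum_(i < n) (_ * (_ + _)) => h1 h0.
have [q0 q1] := andP (q01 n).
have h := bernoulli_cf_approx (c y) (s n) (q01 n).
rewrite !big_ord_recr/= -/S -/rho.
set x := q n * (1 - q n) * s n ^+ 2 in h *.
have -> : - (S + x) / 2 = - S / 2 + - (x / 2) by ring.
rewrite expRD.
have S0 : 0 <= S.
  apply: sumr_ge0 => i _; have /andP[qi0 qi1] := q01 i.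
  by apply: mulr_ge0; [apply: mulr_ge0; rewrite ?subr_ge0|exact: sqr_ge0].
set e := expR (- S / 2) in h1 h0 *.
have e1 : e <= 1 by rewrite /e -expR0 ler_expR mulNr oppr_le0 divr_ge0.
have e0 : 0 <= e by exact: expR_ge0.
set C1 := cos (c y + (1 - q n) * s n) in h h1.
set C0 := cos (c y + (0 - q n) * s n) in h h0.
have -> : q n * B1 + (1 - q n) * B0 - e * expR (- (x / 2)) * cos (c y) =
  (q n * (B1 - e * C1) + (1 - q n) * (B0 - e * C0)) +
  e * (q n * C1 + (1 - q n) * C0 - expR (- (x / 2)) * cos (c y)) by ring.
apply: le_trans (ler_normD _ _) _; apply: lerD.
  apply: le_trans (ler_normD _ _) _; rewrite !normrM (ger0_norm q0).
  rewrite (@ger0_norm _ (1 - q n)) ?subr_ge0//.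
  have -> : rho = q n * rho + (1 - q n) * rho by ring.
  by apply: lerD; apply: ler_wpM2l => //; rewrite subr_ge0.
rewrite normrM (ger0_norm e0); apply: le_trans h.
by rewrite ler_piMl.
Qed.

End bernoulli_mean.

(** * Trigonometric approximation *)

Section trigonometric_polynomials.
Variables (R : realType) (p : nat).
Set Implicit Arguments. Unset Strict Implicit.
Implicit Types (u w : 'cV[R]_p) (g h : 'cV[R]_p -> R).

Lemma dotvE u w : dotv u w = \sum_(i < p) u i ord0 * w i ord0.
Proof. by rewrite /dotv mxE; apply: eq_bigr => i _; rewrite mxE. Qed.

Lemma dotvDl u u' w : dotv (u + u') w = dotv u w + dotv u' w.
Proof. by rewrite /dotv linearD/= mulmxDl mxE. Qed.

Lemma dotvNl u w : dotv (- u) w = - dotv u w.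
Proof. by rewrite /dotv linearN/= mulNmx mxE. Qed.

Lemma dotvC u w : dotv u w = dotv w u.
Proof. by rewrite !dotvE; apply: eq_bigr => i _; rewrite mulrC. Qed.

Lemma dotv0l w : dotv 0 w = 0.
Proof. by rewrite /dotv trmx0 mul0mx mxE. Qed.

Lemma dotvBr u w w' : dotv u (w - w') = dotv u w - dotv u w'.
Proof. by rewrite dotvC dotvDl dotvNl !(dotvC _ u). Qed.

(** A triple holds amplitude, frequency vector and phase. The phase lets cosines alone cover sines,
    and a list of terms makes products and Gaussian means computable term by term. *)
Definition trig_eval (l : seq (R * 'cV[R]_p * R)) u : R :=
  \sum_(a <- l) a.1.1 * cos (a.2 + dotv a.1.2 u).

Definition is_trig g := exists l, g =1 trig_eval l.

Lemma is_trig_ext g h : g =1 h -> is_trig g -> is_trig h.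
Proof. by move=> gh [l hl]; exists l => u; rewrite -gh. Qed.

Lemma is_trig_cst (c : R) : is_trig (fun=> c).
Proof.
exists [:: (c, 0, 0)] => u.
by rewrite /trig_eval big_seq1/= dotv0l addr0 cos0 mulr1.
Qed.

Lemma is_trigD g h : is_trig g -> is_trig h -> is_trig (fun u => g u + h u).
Proof.
move=> [l hl] [m hm]; exists (l ++ m) => u.
by rewrite hl hm /trig_eval big_cat.
Qed.

Lemma cosM_sum (a b : R) : cos a * cos b = (cos (a + b) + cos (a - b)) / 2.
Proof. by rewrite cosB cosD; field. Qed.

Lemma is_trig_mul_cos (c : R) (th : 'cV[R]_p) (ph : R) g : is_trig g ->
  is_trig (fun u => c * cos (ph + dotv th u) * g u).
Proof.
move=> [l hl].
exists ([seq (a.1.1 * c / 2, a.1.2 + th, a.2 + ph) | a <- l]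
     ++ [seq (a.1.1 * c / 2, a.1.2 - th, a.2 - ph) | a <- l]) => u.
rewrite hl /trig_eval big_cat/= !big_map/= mulr_sumr -big_split/=.
apply: eq_bigr => a _; rewrite !dotvDl dotvNl.
rewrite mulrACA [cos _ * cos _]mulrC cosM_sum.
rewrite (_ : a.2 + ph + (dotv a.1.2 u + dotv th u) =
             a.2 + dotv a.1.2 u + (ph + dotv th u)); last by ring.
rewrite (_ : a.2 - ph + (dotv a.1.2 u - dotv th u) =
             a.2 + dotv a.1.2 u - (ph + dotv th u)); last by ring.
by field.
Qed.

Lemma is_trigM g h : is_trig g -> is_trig h -> is_trig (fun u => g u * h u).
Proof.
move=> [l hl] hh; elim: l g hl => [|a l ih] g hl.
  apply: is_trig_ext (is_trig_cst 0) => u.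
  by rewrite hl /trig_eval big_nil mul0r.
apply: (@is_trig_ext (fun u => a.1.1 * cos (a.2 + dotv a.1.2 u) * h u
                         + trig_eval l u * h u)).
  by move=> u; rewrite hl /trig_eval big_cons mulrDl.
by apply: is_trigD; [exact: is_trig_mul_cos|exact: ih].
Qed.

Lemma is_trig_sin (j : 'I_p) (c : R) : is_trig (fun u => sin (c * u j ord0)).
Proof.
exists [:: (1, c *: delta_mx j ord0, - (pi / 2))] => u.
rewrite /trig_eval big_seq1/= mul1r addrC cosBpihalf dotvE (bigD1 j)//=.
rewrite big1 ?addr0 => [|i ij]; first by rewrite !mxE !eqxx mulr1.
by rewrite !mxE (negbTE ij) mulr0 mul0r.
Qed.

(** With the outcomes summed out, the mean is a polynomial in the success probabilities, whatever
    [G] is. *)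
Lemma is_trig_bern_mean (q : 'cV[R]_p -> nat -> R) n G y :
  (forall i, is_trig (q ^~ i)) -> is_trig (fun u => bern_mean (q u) n G y).
Proof.
move=> hq; elim: n y => [|n ih] y /=; first exact: is_trig_cst.
apply: is_trigD; apply: is_trigM => //.
apply: is_trigD; first exact: is_trig_cst.
apply: is_trig_ext (is_trigM (is_trig_cst (- 1)) (hq n)) => u.
by rewrite mulN1r.
Qed.

Lemma ler_norm_cosB (a b : R) : `|cos a - cos b| <= `|a - b|.
Proof.
wlog ab : a b / a <= b.
  move=> H; have [/H//|/ltW/H] := leP a b.
  by rewrite distrC [leRHS]distrC.
have -> : `|a - b| = b - a by rewrite distrC ger0_norm ?subr_ge0.
rewrite ler_norml; apply/andP; split.
  pose F t : R := t - cos t; suff : F a <= F b by rewrite /F; lra.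
  apply: (@deriv_ge0_le _ F (fun t => 1 + sin t) a b) => // x _.
    by apply: is_derive_eq; rewrite /GRing.scale/=; ring.
pose F t : R := t + cos t; suff : F a <= F b by rewrite /F; lra.
apply: (@deriv_ge0_le _ F (fun t => 1 - sin t) a b) => //.
Qed.

Lemma is_trig_lipschitz g : is_trig g -> exists2 C : R, 0 <= C &
  forall u w d, 0 <= d -> (forall i, `|u i ord0 - w i ord0| <= d) ->
    `|g u - g w| <= C * d.
Proof.
move=> [l hl]; elim: l g hl => [|a l ih] g hl.
  exists 0 => // u w d _ _.
  by rewrite !hl /trig_eval !big_nil subrr normr0 mul0r.
have [C C0 hC] := ih (trig_eval l) (fun=> erefl).
exists (`|a.1.1| * (\sum_(i < p) `|a.1.2 i ord0|) + C).
  by rewrite addr_ge0 ?mulr_ge0 ?sumr_ge0.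
move=> u w d d0 uw; rewrite !hl /trig_eval !big_cons -/(trig_eval l u).
rewrite -/(trig_eval l w) opprD addrACA mulrDl.
apply: le_trans (ler_normD _ _) _; apply: lerD; last exact: hC.
rewrite -mulrBr normrM -mulrA ler_wpM2l//.
apply: le_trans (ler_norm_cosB _ _) _.
rewrite opprD addrACA subrr add0r -dotvBr dotvE mulr_suml.
apply: le_trans (ler_norm_sum _ _ _) _; apply: ler_sum => i _.
by rewrite normrM !mxE ler_wpM2l.
Qed.

End trigonometric_polynomials.

Section trigonometric_approximation.
Variables (R : realType) (p : nat).
Set Implicit Arguments. Unset Strict Implicit.

(** Uniform continuity in which only the base point [b] stays in the compact set. Around each point
    of the cover half of the radius is spent on reaching [b] and the other half on reaching [a]. *)
Lemma compact_modulus (h : 'rV[R]_p -> R) (A : set 'rV[R]_p) (e : R) :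
  continuous h -> compact A -> 0 < e ->
  exists2 d : R, 0 < d & forall b a : 'rV[R]_p, A b ->
    (forall j, `|a ord0 j - b ord0 j| < d) -> `|h a - h b| < e.
Proof.
move=> ch cA e0.
have e20 : 0 < e / 2 by rewrite divr_gt0.
pose P (d : R) (b : 'rV[R]_p) :=
  forall a : 'rV[R]_p, (forall j, `|a ord0 j - b ord0 j| < d) -> `|h a - h b| < e.
have : \forall d \near 0^'+, A `<=` P d.
  apply: (proj1 (compact_near_coveringP A) cA) => b Ab.
  have /cvgrPdist_lt/(_ _ e20) := ch b.
  rewrite -nbhs_ballE => -[r /= r0 hr].
  have r2 : 0 < r / 2 by rewrite divr_gt0.
  exists (ball b (r / 2), [set d | 0 < d < r / 2]) => /=.
    split; first exact: nbhsx_ballx.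
    by near=> d; apply/andP; split; near: d; [exact: nbhs_right_gt|exact: nbhs_right_lt].
  move=> [b' d] /= [[_ bb'] /andP[d0 dr]] a ab'.
  have h1 : `|h b - h b'| < e / 2.
    apply: hr; split => // i j; rewrite ord1.
    by have := bb' ord0 j; rewrite /ball/= => /lt_trans; apply; lra.
  have h2 : `|h b - h a| < e / 2.
    apply: hr; split => // i j; rewrite ord1.
    have := bb' ord0 j; have := ab' j; rewrite /ball/= => h3 h4.
    rewrite (_ : b ord0 j - a ord0 j =
      (b ord0 j - b' ord0 j) - (a ord0 j - b' ord0 j)); last by ring.
    by apply: le_lt_trans (ler_normB _ _) _; lra.
  rewrite (_ : h a - h b' = (h b - h b') - (h b - h a)); last by ring.
  by apply: le_lt_trans (ler_normB _ _) _; lra.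
move=> H; near (0 : R)^'+ => d.
exists d; first by near: d; exact: nbhs_right_gt.
by near: d; apply: filterS H => d AP b a Ab; exact: AP.
Unshelve. all: by end_near. Qed.

(** Chebyshev in pointwise form: if some coordinate differs by at least [d], then 2 M is at most (2
    M / d^2) times the squared distance. Averaging the right-hand side needs variances only. *)
Lemma modulus_quadratic (h : 'rV[R]_p -> R) (A : set 'rV[R]_p) (M e : R) :
  continuous h -> compact A -> (forall a, `|h a| <= M) -> 0 < e ->
  exists2 C : R, 0 <= C & forall b a : 'rV[R]_p, A b ->
    `|h a - h b| <= e + C * \sum_(j < p) (a ord0 j - b ord0 j) ^+ 2.
Proof.
move=> ch cA hM e0; have [d d0 hd] := compact_modulus ch cA e0.
have M0 : 0 <= M by apply: le_trans (hM 0).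
exists (2 * M / d ^+ 2); first by rewrite divr_ge0 ?sqr_ge0// mulr_ge0.
move=> b a Ab.
have S0 : 0 <= \sum_(j < p) (a ord0 j - b ord0 j) ^+ 2.
  by apply: sumr_ge0 => j _; exact: sqr_ge0.
have [H|/existsNP[j /negP]] := pselect (forall j, `|a ord0 j - b ord0 j| < d).
  rewrite -[leLHS]addr0; apply: lerD; first exact/ltW/hd.
  by rewrite mulr_ge0// divr_ge0 ?sqr_ge0// mulr_ge0.
rewrite -leNgt => dj; apply: (@le_trans _ _ (2 * M)).
  by apply: le_trans (ler_normB _ _) _; have := hM a; have := hM b; lra.
rewrite -[leLHS]add0r; apply: lerD; first exact: ltW.
rewrite mulrAC ler_pdivlMr ?exprn_gt0//; apply: ler_wpM2l; first exact: mulr_ge0.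
rewrite (bigD1 j)//= -[leLHS]addr0; apply: lerD.
  by rewrite -[leRHS]real_normK ?num_real// lerXn2r ?nnegrE ?(ltW d0).
by apply: sumr_ge0 => i _; exact: sqr_ge0.
Qed.

(** Truncation to [-1/2, 1/2]. It keeps the argument of [asin] away from the end points -1 and 1, so
    that the composite is continuous on the whole line. *)
Definition clamp_half (y : R) : R := (`|y + 1 / 2| - `|y - 1 / 2|) / 2.

Lemma clamp_half_id y : `|y| <= 1 / 2 -> clamp_half y = y.
Proof.
rewrite /clamp_half ler_norml => /andP[y1 y2].
by rewrite ger0_norm ?ler0_norm; lra.
Qed.

Lemma clamp_half_bound y : `|clamp_half y| <= 1 / 2.
Proof.
rewrite /clamp_half ler_norml.
have [a|a] := leP 0 (y + 1 / 2); have [b|b] := leP 0 (y - 1 / 2);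
by rewrite ?(ger0_norm a) ?(ger0_norm b) ?(ltr0_norm a) ?(ltr0_norm b); lra.
Qed.

Lemma continuous_clamp_half : continuous clamp_half.
Proof.
move=> y; apply: cvgM; last exact: cvg_cst.
apply: cvgB; apply: cvg_norm; first by apply: cvgD; [exact: cvg_id|exact: cvg_cst].
by apply: cvgB; [exact: cvg_id|exact: cvg_cst].
Qed.

Lemma sum_block N j : (j < p)%N ->
  \sum_(i < p * N) (((i %/ N)%N == j)%:R : R) = N%:R.
Proof.
have [->|N0] := posnP N; first by rewrite muln0 big_ord0.
elim: p => [//|k ih]; rewrite ltnS leq_eqVlt => jk.
rewrite mulSnr big_split_ord/=.
rewrite [X in _ + X](eq_bigr (fun=> (k == j)%:R)); last first.
  by move=> i _; rewrite divnMDl// divn_small ?addn0.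
rewrite sumr_const card_ord.
case/orP : jk => [/eqP ->|jk'].
  rewrite eqxx big1 ?add0r// => i _.
  by rewrite (ltn_eqF (_ : (i %/ N < k)%N))// ltn_divLR.
by rewrite (gtn_eqF jk') ih// mul0rn addr0.
Qed.

(** On the cube, [f] is a continuous function [h] of y_j = (1 + sin(u_j / La)) / 2 in [0, 1]. The
    Bernstein polynomial of [h] at y is the mean of [h] at block averages of Bernoulli variables
    with means y_j; as a mean it inherits the bound [M] for all u, not only inside the cube. *)
Lemma trig_approx (f : 'cV[R]_p -> R) (M L e : R) :
  continuous f -> (forall u, `|f u| <= M) -> 0 < L -> 0 < e ->
  exists g, [/\ is_trig g, (forall u, `|g u| <= M) &
    forall u : 'cV[R]_p, (forall j, `|u j ord0| <= L) -> `|f u - g u| <= e].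
Proof.
move=> cf fM L0 e0.
(* The factor 2 gives |u_j / La| <= 1/2 on the cube, so the sine stays in the range where
   [clamp_half] is the identity and [asin] inverts it. *)
pose La := 2 * L; have La0 : 0 < La by rewrite mulr_gt0.
pose h (y : 'rV[R]_p) : R :=
  f (\col_j (La * asin (clamp_half (2 * y ord0 j - 1)))).
have ch : continuous h.
  move=> y; apply: continuous_comp; last exact: cf.
  move: y => /= y.
  pose phi (t : R) : R := La * asin (clamp_half (2 * t - 1)).
  have cphi : continuous phi.
    move=> t; apply: (@continuous_comp _ _ _
      (fun t : R => asin (clamp_half (2 * t - 1))) ( *%R La));
      last exact: mulrl_continuous.
    apply: (@continuous_comp _ _ _ (fun t : R => clamp_half (2 * t - 1)) asin).
      apply: (@continuous_comp _ _ _ (fun t : R => 2 * t - 1) clamp_half).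
        by apply: cvgB; [exact: mulrl_continuous|exact: cvg_cst].
      exact: continuous_clamp_half.
    apply: continuous_asin.
    by have := clamp_half_bound (2 * t - 1); rewrite ler_norml; lra.
  have ca (j : 'I_p) : (fun y : 'rV[R]_p => phi (y ord0 j)) @ y --> phi (y ord0 j).
    apply: (@continuous_comp _ _ _ (fun y : 'rV[R]_p => y ord0 j) phi).
      exact: coord_continuous.
    exact: cphi.
  move=> B /nbhs_ballP[r /= r0 rB].
  have : \forall t \near y, forall j : 'I_p,
    ball (phi (y ord0 j)) r (phi ((t : 'rV[R]_p) ord0 j)).
    by apply: (filter_forall (nbhs_filter y)) => j; move/cvg_ballP : (ca j); apply.
  apply: filterS => t H; apply: rB; split => // i j; rewrite !mxE; exact: H.
have hM y : `|h y| <= M by exact: fM.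
have cA : compact [set y : 'rV[R]_p | forall j, `[0, 1]%classic (y ord0 j)].
  exact: (@rV_compact R p (fun=> `[0, 1]%classic) (fun=> @segment_compact _ _ _)).
have e20 : 0 < e / 2 by rewrite divr_gt0.
have [C C0 hC] := modulus_quadratic ch cA hM e20.
pose yu (u : 'cV[R]_p) (j : 'I_p) : R := (1 + sin (La^-1 * u j ord0)) / 2.
have yu01 u j : 0 <= yu u j <= 1.
  have := sin_geN1 (La^-1 * u j ord0); have := sin_le1 (La^-1 * u j ord0).
  by rewrite /yu; lra.
(* Each block average has variance at most 1/N; [N] is chosen so that the p variances, weighted by
   [C], use up the second half of [e]. *)
pose N := (Num.truncn (2 * C * p%:R / e)).+1.
have N0 : 0 < N%:R :> R by rewrite ltr0n.
have hN : C * p%:R / N%:R <= e / 2.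
  have : 2 * C * p%:R / e < N%:R by exact: truncnS_gt.
  by rewrite ltr_pdivrMr// ler_pdivrMr//; lra.
(* Block [j] consists of [N] Bernoulli variables of mean [yu u j], and [S z]
   collects the block averages. *)
pose q u i : R := if insub ((i %/ N)%N) is Some j then yu u j else 0.
have q01 u i : 0 <= q u i <= 1.
  by rewrite /q; case: insubP => [j _ _|_]; [exact: yu01|rewrite lexx ler01].
pose s (j : 'I_p) i : R := ((i %/ N)%N == j)%:R / N%:R.
pose S (z : nat -> R) : 'rV[R]_p := \row_j \sum_(i < p * N) z i * s j i.
pose g u := bern_mean (q u) (p * N) (fun z => h (S z)) (fun=> 0).
have trig_g : is_trig g.
  apply: is_trig_bern_mean => i; rewrite /q.
  case: insubP => [j _ _|_]; last exact: is_trig_cst.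
  apply: is_trig_ext (is_trigM (is_trigD (is_trig_cst _ 1) (is_trig_sin j La^-1))
     (is_trig_cst _ 2^-1)) => u; by [].
have meanS u j : \sum_(i < p * N) q u i * s j i = yu u j.
  transitivity (\sum_(i < p * N) (((i %/ N)%N == j)%:R / N%:R * yu u j)).
    apply: eq_bigr => i _; rewrite /q /s mulrC.
    have [ij|] := eqVneq (i %/ N)%N (j : nat); last by rewrite !mul0r.
    by rewrite ij valK.
  by rewrite -mulr_suml -mulr_suml sum_block// divff ?mul1r// gt_eqF.
have varS u (j : 'I_p) z : bern_mean (q u) (p * N)
    (fun z => (S z ord0 j - yu u j) ^+ 2) z <= N%:R^-1.
  have E z' : (S z' ord0 j - yu u j) ^+ 2 =
     (0 + \sum_(i < p * N) (z' i - q u i) * s j i) ^+ 2.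
    rewrite mxE -meanS -sumrB add0r; congr (_ ^+ 2); apply: eq_bigr => i _.
    by rewrite mulrBl.
  rewrite (eq_bern_mean _ _ _ E) (@bern_mean_sqr _ _ _ _ (fun=> 0))//.
  rewrite expr0n/= add0r.
  apply: (@le_trans _ _ (\sum_(i < p * N) ((i %/ N)%N == j)%:R / N%:R ^+ 2)).
    apply: ler_sum => i _.
    have -> : s j i ^+ 2 = ((i %/ N)%N == j)%:R / N%:R ^+ 2.
      by rewrite /s expr_div_n; congr (_ / _); case: eqP => _; rewrite ?expr1n ?expr0n.
    rewrite ler_piMl ?divr_ge0 ?sqr_ge0//.
    by have /andP[a b] := q01 u i; rewrite mulr_ile1// ?subr_ge0//; lra.
  rewrite -mulr_suml sum_block//.
  by rewrite expr2 invfM mulrA divff ?mul1r// gt_eqF.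
exists g; split => //.
  move=> u; rewrite -[g u]subr0.
  rewrite -[leRHS](bern_mean_cst (q u) (p * N) M (fun=> 0)).
  by apply: ler_norm_bern_meanB => // z; rewrite subr0.
move=> u uL.
have -> : f u = h (\row_j yu u j).
  rewrite /h; congr f; apply/matrixP => j k; rewrite !mxE ord1.
  have -> : 2 * yu u j - 1 = sin (La^-1 * u j ord0) by rewrite /yu; field.
  have uj : `|La^-1 * u j ord0| <= 1 / 2.
    rewrite normrM gtr0_norm ?invr_gt0// mulrC ler_pdivrMr//.
    by apply: le_trans (uL j) _; rewrite /La; lra.
  rewrite clamp_half_id; last first.
    move: uj; rewrite !ler_norml.
    set t := _^-1 * _ => /andP[t1 t2].
    have [t0|t0] := leP 0 t.
      have := sin_le_id t0.
      have : 0 <= sin t by apply: sin_ge0_pi; have := pihalf_ge1 R; lra.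
      lra.
    have t0' : 0 <= - t by lra.
    have := sin_le_id t0'.
    have : 0 <= sin (- t) by apply: sin_ge0_pi; have := pihalf_ge1 R; lra.
    rewrite sinN; lra.
  rewrite sinK ?mulVKf ?gt_eqF//.
  by rewrite in_itv/=; have := pihalf_ge1 R; move: uj; rewrite ler_norml; lra.
rewrite distrC.
have Au : [set y : 'rV[R]_p | forall j, `[0, 1]%classic (y ord0 j)] (\row_j yu u j).
  by move=> j /=; rewrite mxE in_itv/=.
apply: (@le_trans _ _ (bern_mean (q u) (p * N)
   (fun z => e / 2 + C * \sum_(j < p) (S z ord0 j - yu u j) ^+ 2) (fun=> 0))).
  apply: ler_norm_bern_meanB => // z.
  have := hC _ (S z) Au; under eq_bigr do rewrite [_ (\row_j yu u j) _ _]mxE.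
  by [].
rewrite bern_meanD bern_mean_cst bern_meanZ bern_mean_sum.
suff : C * \sum_(j < p) bern_mean (q u) (p * N)
    (fun z => (S z ord0 j - yu u j) ^+ 2) (fun=> 0) <= e / 2 by lra.
apply: le_trans hN; rewrite -mulrA; apply: ler_wpM2l => //.
apply: (@le_trans _ _ (\sum_(j < p) N%:R^-1)); first by apply: ler_sum.
by rewrite sumr_const card_ord -[leLHS]mulr_natl.
Qed.

End trigonometric_approximation.

(** * Integrals against the standard normal law *)

Section integral_sandwich.
Context d (T : measurableType d) (R : realType) (mu : {measure set T -> \bar R}).
Set Implicit Arguments. Unset Strict Implicit.

(* The integral of a nonnegative function is a supremum over the simple
   functions below it, so monotonicity does not need measurability. *)
Lemma le_integral_nonmeas (f g : T -> \bar R) :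
  (forall x, f x <= g x)%E -> (\int[mu]_x f x <= \int[mu]_x g x)%E.
Proof.
have ge0 (u v : T -> \bar R) : (forall x, 0 <= u x)%E ->
    (forall x, u x <= v x)%E -> (\int[mu]_x u x <= \int[mu]_x v x)%E.
  move=> u0 uv; have v0 x : (0 <= v x)%E by exact: le_trans (u0 x) (uv x).
  rewrite !ge0_integralTE//; apply: le_ereal_sup => _ [h hu <-].
  by exists h => // x; apply: le_trans (hu x) _.
move=> fg; rewrite integralE [leRHS]integralE; apply: leeB.
  apply: ge0 => x; first exact: funepos_ge0.
  by rewrite !funeposE ge_max !le_max fg lexx orbT.
apply: ge0 => x; first exact: funeneg_ge0.
by rewrite !funenegE ge_max !le_max leeN2 fg lexx orbT.
Qed.

(** The integral of [h] is caught between the finite integrals of B - D and B + D, so it is finite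
    and [fine] loses nothing. Integrability is asked of the comparison functions; [h] will be an
    inner Gaussian integral or a test function of the estimator. *)
Lemma Rintegral_sandwich (h B D : T -> R) :
  mu.-integrable setT (EFin \o B) -> mu.-integrable setT (EFin \o D) ->
  (forall x, `|h x - B x| <= D x) ->
  `|Rintegral mu setT h - Rintegral mu setT B| <= Rintegral mu setT D.
Proof.
move=> iB iD hBD.
have fB := integrable_fin_num measurableT iB.
have fD := integrable_fin_num measurableT iD.
have up : (\int[mu]_x (h x)%:E <= \int[mu]_x (B x)%:E + \int[mu]_x (D x)%:E)%E.
  rewrite -(integralD_EFin measurableT iB iD); apply: le_integral_nonmeas => x /=.
  by rewrite -EFinD lee_fin; have := hBD x; rewrite ler_norml; lra.
have lo : (\int[mu]_x (B x)%:E - \int[mu]_x (D x)%:E <= \int[mu]_x (h x)%:E)%E.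
  rewrite -(integralB_EFin measurableT iB iD); apply: le_integral_nonmeas => x /=.
  by rewrite -EFinB lee_fin; have := hBD x; rewrite ler_norml; lra.
rewrite /Rintegral.
rewrite /= in fB fD.
move: up lo; rewrite -(fineK fB) -(fineK fD) -EFinD -EFinB /=.
set b := fine _; set dd := fine _.
case: (\int[mu]_x (h x)%:E)%E => [r| |] //=; rewrite !lee_fin => up lo.
by rewrite ler_norml; lra.
Qed.

End integral_sandwich.

Section normal_integrals.
Variable R : realType.
Set Implicit Arguments. Unset Strict Implicit.
Let mu := @lebesgue_measure R.
Let N := @normal_prob R 0 1.
Let pdf := @normal_pdf R 0 1.

(** The Radon-Nikodym derivative of the normal law and its density have the same integral over every
    measurable set, hence agree almost everywhere. *)
Lemma ge0_integral_normal (f : R -> \bar R) : (forall x, 0 <= f x)%E ->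
  measurable_fun setT f ->
  (\int[N]_x f x = \int[mu]_x (f x * (pdf x)%:E))%E.
Proof.
move=> f0 mf.
have dom := @normal_prob_dominates R 0 1.
rewrite -(Radon_Nikodym_SigmaFinite.change_of_variables dom f0 measurableT mf).
have iRN := Radon_Nikodym_SigmaFinite.f_integrable dom.
apply: ae_eq_integral => //.
- by apply: emeasurable_funM => //; exact: measurable_int iRN.
- apply: emeasurable_funM => //; apply/measurable_EFinP.
  exact: measurable_normal_pdf.
- apply: ae_eqe_mul2l; apply: integral_ae_eq => //.
    by apply/measurable_EFinP; exact: measurable_normal_pdf.
  by move=> E _ mE; rewrite -Radon_Nikodym_SigmaFinite.f_integral.
Qed.

Lemma std_normal_pdfE x : pdf x = normal_peak 1 * expR (- x ^+ 2 / 2).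
Proof.
rewrite /pdf /normal_pdf oner_eq0 /normal_fun subr0 expr1n.
by rewrite mulr2n.
Qed.

(** Integrability of quadratic growth is borrowed from the normal density of standard deviation 2:
    splitting x^2/2 = 3x^2/8 + x^2/8 leaves 1 + x^2 <= 3 exp(3x^2/8). *)
Lemma std_normal_pdf_dom : exists2 K : R, 0 <= K &
  forall x, (1 + x ^+ 2) * pdf x <= K * normal_pdf 0 2 x.
Proof.
have p2 : 0 < @normal_peak R 2 by rewrite normal_peak_gt0// pnatr_eq0.
exists (3 * normal_peak 1 / normal_peak 2).
  by rewrite divr_ge0 ?mulr_ge0 ?normal_peak_ge0.
move=> x; rewrite std_normal_pdfE /normal_pdf pnatr_eq0/=.
rewrite /normal_fun subr0.
have -> : - x ^+ 2 / 2 = - (x ^+ 2 * (3 / 8)) + - x ^+ 2 / (2 ^+ 2 *+ 2) :> R.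
  by rewrite mulr2n; field.
rewrite expRD; set E1 := expR _; set E2 := expR _; set P1 := normal_peak 1.
have -> : 3 * P1 / normal_peak 2 * (normal_peak 2 * E2) = P1 * E2 * 3.
  by field; rewrite gt_eqF.
have -> : (1 + x ^+ 2) * (P1 * (E1 * E2)) = P1 * E2 * ((1 + x ^+ 2) * E1) by ring.
apply: ler_wpM2l; first by rewrite mulr_ge0 ?normal_peak_ge0 ?expR_ge0.
rewrite /E1 expRN ler_pdivrMr ?expR_gt0//.
have := expR_ge1Dx (x ^+ 2 * (3 / 8)).
have := sqr_ge0 x; lra.
Qed.

Lemma integrable_quad_pdf (g : R -> R) (A : R) : measurable_fun setT g ->
  (forall x, `|g x| <= A * (1 + x ^+ 2)) ->
  mu.-integrable setT (EFin \o (fun x => g x * pdf x)).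
Proof.
move=> mg gA; have [K K0 hK] := std_normal_pdf_dom.
have iK : mu.-integrable setT
    (fun x => ((`|A| * K)%:E * (normal_pdf 0 2 x)%:E)%E).
  by apply: integrableZl => //; exact: integrable_normal_pdf.
apply: le_integrable iK => //.
  apply/measurable_EFinP; apply: measurable_funM => //.
  exact: measurable_normal_pdf.
move=> x _ /=; rewrite lee_fin !normrM normr_id.
rewrite (ger0_norm (normal_pdf_ge0 0 1 x)) (ger0_norm (normal_pdf_ge0 0 2 x)).
rewrite (ger0_norm K0) -mulrA.
apply: le_trans (ler_wpM2l (normr_ge0 A) (hK x)).
rewrite mulrA ler_wpM2r ?normal_pdf_ge0//.
apply: le_trans (gA x) _.
by rewrite ler_wpM2r ?ler_norm// addr_ge0// sqr_ge0.
Qed.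

Lemma integrable_quad_normal (g : R -> R) (A : R) : measurable_fun setT g ->
  (forall x, `|g x| <= A * (1 + x ^+ 2)) ->
  N.-integrable setT (EFin \o g).
Proof.
move=> mg gA; have i := integrable_quad_pdf mg gA.
apply/integrableP; split; first exact/measurable_EFinP.
rewrite ge0_integral_normal//; last first.
  by apply: measurableT_comp => //; exact/measurable_EFinP.
have /integrableP[_] := i; congr (_ < _)%E; apply: eq_integral => x _ /=.
by rewrite normrM (ger0_norm (normal_pdf_ge0 0 1 x)) EFinM.
Qed.

Lemma Rintegral_normal (g : R -> R) (A : R) : measurable_fun setT g ->
  (forall x, `|g x| <= A * (1 + x ^+ 2)) ->
  Rintegral N setT g = Rintegral mu setT (fun x => g x * pdf x).
Proof.
move=> mg gA; rewrite /Rintegral; congr fine.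
rewrite integralE [RHS]integralE.
have mg' : measurable_fun setT (fun x => (g x)%:E) by exact/measurable_EFinP.
have p0 x := normal_pdf_ge0 0 1 x : 0 <= pdf x.
rewrite (ge0_integral_normal (funepos_ge0 _) (measurable_funepos mg')).
rewrite (ge0_integral_normal (funeneg_ge0 _) (measurable_funeneg mg')).
congr (_ - _)%E; apply: eq_integral => x _.
- by rewrite !funeposE -!EFin_max -EFinM maxr_pMl// mul0r.
- by rewrite !funenegE -!EFinN -!EFin_max -EFinM maxr_pMl// mul0r mulNr.
Qed.

Lemma is_derive_pdf (x : R) : is_derive x 1 pdf (- x * pdf x).
Proof.
have -> : pdf = (fun x => normal_peak 1 * expR (- x ^+ 2 / 2)).
  by apply/funext => y; exact: std_normal_pdfE.
by apply: is_derive_eq; rewrite /GRing.scale/=; field.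
Qed.

(** Stein's identity. The integrand is the derivative of F times the density; over [-n-1, n+1] its
    integral is a boundary term, which vanishes in the limit since F is bounded, and dominated
    convergence reaches the whole line. *)
Lemma integral_derive_pdf_eq0 (F f : R -> R) (A : R) :
  (forall x : R, is_derive x 1 F (f x)) -> continuous f ->
  (forall x, `|F x| <= 1) ->
  (forall x, `|f x| <= A * (1 + x ^+ 2)) ->
  Rintegral mu setT (fun x => (f x - x * F x) * pdf x) = 0.
Proof.
move=> dF cf F1 fA.
pose G x := F x * pdf x; pose g x := (f x - x * F x) * pdf x.
have dG (x : R) : is_derive x 1 G (g x).
  have := dF x; have := is_derive_pdf x => dp dFx.
  by apply: is_derive_eq; rewrite /GRing.scale/= /g; ring.
have cF : continuous F.
  by move=> x; apply/differentiable_continuous/derivable1_diffP; have [] := dF x.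
have cG : continuous G.
  by move=> x; apply/differentiable_continuous/derivable1_diffP; have [] := dG x.
have ch : continuous (fun x => f x - x * F x).
  move=> x; apply: cvgB; first exact: cf.
  by apply: cvgM; [exact: cvg_id|exact: cF].
have cg : continuous g.
  move=> x; apply: cvgM; first exact: ch.
  by apply: continuous_normal_pdf; exact: oner_neq0.
have ig : mu.-integrable setT (EFin \o g).
  apply: (@integrable_quad_pdf _ (A + 1)); first exact: continuous_measurable_fun.
  move=> x; apply: le_trans (ler_normB _ _) _; rewrite mulrDl mul1r.
  apply: lerD => //; rewrite normrM.
  apply: le_trans (ler_wpM2l (normr_ge0 x) (F1 x)) _; rewrite mulr1 ler_norml.
  by have := sqr_ge0 (x - 1); have := sqr_ge0 (x + 1); nra.
pose I n : set R := `[- n.+1%:R, n.+1%:R]%classic.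
pose u n : \bar R := (\int[mu]_x ((EFin \o g) \_ (I n)) x)%E.
have ucvg : u @ \oo --> (\int[mu]_x (g x)%:E)%E.
  apply: (@dominated_cvg _ _ _ mu setT _ _ (EFin \o g) (fun x => `|(g x)%:E|%E)) => //.
  - move=> n; apply/(measurable_restrictT _ _).1; first exact: measurable_itv.
    exact: measurable_funTS (measurable_int mu ig).
  - move=> x _; apply: cvg_near_cst; near=> n.
    suff xI : x \in I n by rewrite /patch xI.
    rewrite inE /I /= in_itv/= -ler_norml; apply: ltW.
    near: n; exists (Num.truncn `|x|) => // n /= hn.
    by apply: lt_le_trans (truncnS_gt _) _; rewrite ler_nat ltnS.
  - exact: integrable_abse.
  - move=> n x _; rewrite /patch; case: ifP => // _; rewrite abse0.
    exact: abse_ge0.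
have uE n : u n = (G n.+1%:R - G (- n.+1%:R))%:E.
  have nn : - n.+1%:R < n.+1%:R :> R.
    by apply: (@lt_trans _ _ 0); rewrite ?oppr_lt0 ltr0n.
  rewrite /u -integral_mkcond (@continuous_FTC2 _ g G)//.
  - exact: continuous_subspaceT.
  - split.
    + by move=> x _; have [] := dG x.
    + exact/cvg_at_right_filter/cG.
    + exact/cvg_at_left_filter/cG.
  - by move=> x _; rewrite derive1E; have [_ ->] := dG x.
have Gb x : `|G x| <= pdf x.
  by rewrite normrM (ger0_norm (normal_pdf_ge0 _ _ _)) ler_piMl ?normal_pdf_ge0.
have pb n : pdf n.+1%:R <= normal_peak 1 * 2 * n.+1%:R^-1.
  rewrite std_normal_pdfE -mulrA ler_wpM2l ?normal_peak_ge0//.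
  have n0 : 0 < n.+1%:R :> R by rewrite ltr0n.
  rewrite mulNr expRN ler_pdivlMr// mulrC ler_pdivrMr ?expR_gt0//.
  have := expR_ge1Dx (n.+1%:R ^+ 2 / 2 : R).
  have := sqr_ge0 (n.+1%:R - 1 : R); nra.
have pN x : pdf (- x) = pdf x by rewrite !std_normal_pdfE sqrrN.
have vcvg : (fun n => G n.+1%:R - G (- n.+1%:R)) @ \oo --> (0 : R).
  have hc : (fun n => 4 * normal_peak 1 * harmonic n) @ \oo --> (0 : R).
    rewrite -[X in _ --> X](mulr0 (4 * normal_peak 1 : R)).
    by apply: cvgM; [exact: cvg_cst|exact: cvg_harmonic].
  have hc' : (fun n => - (4 * normal_peak 1 * harmonic n)) @ \oo --> (0 : R).
    by rewrite -[X in _ --> X]oppr0; exact: cvgN.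
  apply: squeeze_cvgr hc' hc; apply: nearW => n; rewrite -ler_norml.
  apply: le_trans (ler_normB _ _) _.
  have h1 := Gb n.+1%:R; have h2 := Gb (- n.+1%:R); rewrite pN in h2.
  apply: le_trans (lerD h1 h2) _; apply: le_trans (lerD (pb n) (pb n)) _.
  by rewrite le_eqVlt; apply/orP; left; apply/eqP; rewrite /harmonic/=; ring.
rewrite /Rintegral.
have -> : (\int[mu]_x (g x)%:E)%E = 0%:E; last by [].
have := cvg_unique _ ucvg; apply => //.
have -> : u = EFin \o (fun n => G n.+1%:R - G (- n.+1%:R)) by exact/funext.
by apply: cvg_EFin; [exact: nearW|exact: vcvg].
Unshelve. all: by end_near. Qed.

End normal_integrals.

Section normal_characteristic_function.
Variable R : realType.
Set Implicit Arguments. Unset Strict Implicit.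
Let N := @normal_prob R 0 1.

Lemma continuous_is_derive (f df : R -> R) :
  (forall x : R, is_derive x 1 f (df x)) -> continuous f.
Proof.
by move=> d x; apply/differentiable_continuous/derivable1_diffP; have [] := d x.
Qed.

Lemma is_derive_cos_affine (c t x : R) :
  is_derive x 1 (fun x => cos (c + t * x)) (- (t * sin (c + t * x))).
Proof. by apply: is_derive_eq; rewrite /GRing.scale/=; ring. Qed.

Lemma is_derive_sin_affine (c t x : R) :
  is_derive x 1 (fun x => sin (c + t * x)) (t * cos (c + t * x)).
Proof. by apply: is_derive_eq; rewrite /GRing.scale/=; ring. Qed.

Lemma continuous_cos_affine (c t : R) : continuous (fun x : R => cos (c + t * x)).
Proof. exact: continuous_is_derive (is_derive_cos_affine c t). Qed.

Lemma continuous_sin_affine (c t : R) : continuous (fun x : R => sin (c + t * x)).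
Proof. exact: continuous_is_derive (is_derive_sin_affine c t). Qed.

Lemma ler_norm_1Dsqr (x : R) : `|x| <= 1 + x ^+ 2.
Proof.
rewrite ler_norml.
by have := sqr_ge0 (x - 1); have := sqr_ge0 (x + 1); nra.
Qed.

Lemma normal_cos_integrable (c t : R) :
  N.-integrable setT (EFin \o (fun x => cos (c + t * x))).
Proof.
apply: (@integrable_quad_normal _ _ 1).
  by apply: continuous_measurable_fun; exact: continuous_cos_affine.
move=> x; rewrite mul1r; apply: (@le_trans _ _ 1).
  by rewrite ler_norml cos_geN1 cos_le1.
by rewrite lerDl sqr_ge0.
Qed.

Lemma normal_xsin_integrable (c t : R) :
  N.-integrable setT (EFin \o (fun x => - (x * sin (c + t * x)))).
Proof.
apply: (@integrable_quad_normal _ _ 1).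
  apply: continuous_measurable_fun => x; apply: cvgN.
  by apply: cvgM; [exact: cvg_id|exact: continuous_sin_affine].
move=> x; rewrite mul1r normrN normrM; apply: le_trans (ler_norm_1Dsqr x).
by rewrite ler_piMr// ler_norml sin_geN1 sin_le1.
Qed.

Lemma normal_sqr_integrable :
  N.-integrable setT (EFin \o (fun x : R => x ^+ 2)).
Proof.
apply: (@integrable_quad_normal _ _ 1).
  by apply: continuous_measurable_fun; exact: exprn_continuous.
by move=> x; rewrite mul1r ger0_norm ?sqr_ge0// lerDr.
Qed.

Lemma normal_cst_integrable (r : R) : N.-integrable setT (EFin \o (fun=> r)).
Proof.
apply: (@integrable_quad_normal _ _ `|r|) => [|x]; first exact: measurable_cst.
by rewrite ler_peMr// lerDl sqr_ge0.
Qed.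

Lemma Rintegral_normal_cst (r : R) : Rintegral N setT (fun=> r) = r.
Proof.
rewrite Rintegral_cst//= -[X in r * fine X]/(N setT).
by rewrite [N setT]probability_setT mulr1.
Qed.

(* Integration by parts: the derivative of [sin (c + t x)] times the density
   integrates to zero. *)
Lemma normal_xsin (c t : R) :
  Rintegral N setT (fun x => - (x * sin (c + t * x))) =
  - t * Rintegral N setT (fun x => cos (c + t * x)).
Proof.
have mc : measurable_fun setT (fun x : R => t * cos (c + t * x)).
  apply: measurable_funM => //.
  by apply: continuous_measurable_fun; exact: continuous_cos_affine.
have bc (x : R) : `|t * cos (c + t * x)| <= `|t| * (1 + x ^+ 2).
  rewrite normrM ler_wpM2l//; apply: (@le_trans _ _ 1).
    by rewrite ler_norml cos_geN1 cos_le1.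
  by rewrite lerDl sqr_ge0.
have ic : N.-integrable setT (EFin \o (fun x => t * cos (c + t * x))).
  exact: integrable_quad_normal mc bc.
have is_ := normal_xsin_integrable c t.
have E := RintegralD measurableT ic is_.
have Z := RintegralZl t measurableT (normal_cos_integrable c t).
suff H : Rintegral N setT
    (fun x => t * cos (c + t * x) + - (x * sin (c + t * x))) = 0.
  by move: E; rewrite H Z; lra.
rewrite (@Rintegral_normal _ _ (`|t| + 1)); last 2 first.
- by apply: measurable_funD => //; have /integrableP[/measurable_EFinP] := is_.
- move=> x; apply: le_trans (ler_normD _ _) _; rewrite mulrDl mul1r.
  apply: lerD => //; rewrite normrN normrM; apply: le_trans (ler_norm_1Dsqr x).
  by rewrite ler_piMr// ler_norml sin_geN1 sin_le1.
apply: (@integral_derive_pdf_eq0 _ (fun x => sin (c + t * x))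
   (fun x => t * cos (c + t * x)) `|t|) => //.
- exact: is_derive_sin_affine.
- move=> x; apply: cvgM; first exact: cvg_cst.
  exact: continuous_cos_affine.
- by move=> x; rewrite ler_norml sin_geN1 sin_le1.
Qed.

(** As a function of the frequency s the integral [psi] satisfies psi' = - s psi: differentiate
    under the integral sign, dominated by 1 + x^2, and integrate by parts. So psi(s) exp(s^2/2) is
    constant, with value cos c at s = 0. *)
Lemma normal_cf (c t : R) : Rintegral N setT (fun x => cos (c + t * x)) =
  expR (- t ^+ 2 / 2) * cos c.
Proof.
pose psi t := Rintegral N setT (fun x => cos (c + t * x)).
pose f (t x : R) := cos (c + t * x).
have df (s x : R) : is_derive s 1 (f ^~ x) (- (x * sin (c + s * x))).
  by rewrite /f; apply: is_derive_eq; rewrite /GRing.scale/=; ring.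
have pf (s x : R) : partial1of2 f s x = - (x * sin (c + s * x)).
  by rewrite partial1of2E; have [_ ->] := df s x.
have iG : N.-integrable setT (EFin \o (fun x : R => 1 + x ^+ 2)).
  apply: (@integrable_quad_normal _ _ 1).
    exact: measurable_funD.
  by move=> x; rewrite mul1r ger0_norm// addr_ge0 ?sqr_ge0.
have dpsi (s : R) : is_derive s 1 psi (- s * psi s).
  have Is : `]s - 1, s + 1[%classic s by rewrite /= in_itv/=; lra.
  have i1 x : `]s - 1, s + 1[%classic x -> N.-integrable setT (EFin \o f x).
    by move=> _; exact: normal_cos_integrable.
  have d1 (x y : R) : `]s - 1, s + 1[%classic x -> setT y -> derivable (f ^~ y) x 1.
    by move=> _ _; have [] := df x y.
  have G0 (y : R) : 0 <= 1 + y ^+ 2 by rewrite addr_ge0 ?sqr_ge0.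
  have Gub (x y : R) : `]s - 1, s + 1[%classic x -> setT y ->
      `|partial1of2 f x y| <= 1 + y ^+ 2.
    move=> _ _; rewrite pf normrN normrM; apply: le_trans (ler_norm_1Dsqr y).
    by rewrite ler_piMr// ler_norml sin_geN1 sin_le1.
  split; first exact: (derivable_under_integral measurableT Is i1 d1 G0 iG Gub).
  have := differentiation_under_integral measurableT Is i1 d1 G0 iG Gub.
  rewrite derive1E => ->; rewrite -normal_xsin.
  by apply: eq_Rintegral => x _; rewrite pf.
have dh (s : R) : is_derive s 1 (fun s => psi s * expR (s ^+ 2 / 2)) 0.
  have := dpsi s => dps; apply: is_derive_eq.
  by rewrite /GRing.scale/=; field.
have := is_derive_0_is_cst t 0 dh.
rewrite expr0n/= mul0r expR0 mulr1 => H.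
have -> : Rintegral N setT (fun x => cos (c + t * x)) = psi t by [].
have -> : psi t = psi 0 * expR (- t ^+ 2 / 2).
  rewrite -H -mulrA -expRD.
  by rewrite (_ : _ + _ = 0) ?expR0 ?mulr1//; field.
rewrite mulrC; congr (_ * _); rewrite /psi -[RHS]Rintegral_normal_cst.
by apply: eq_Rintegral => x _; rewrite mul0r addr0.
Qed.

Lemma normal_cos_sum (I : Type) (l : seq I) (w c t : I -> R) :
  N.-integrable setT
    (EFin \o (fun x => \sum_(a <- l) w a * cos (c a + t a * x))) /\
  Rintegral N setT (fun x => \sum_(a <- l) w a * cos (c a + t a * x)) =
  \sum_(a <- l) w a * (expR (- t a ^+ 2 / 2) * cos (c a)).
Proof.
elim: l => [|a l [il El]].
  under eq_fun do rewrite big_nil; rewrite big_nil Rintegral_normal_cst; split => //.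
  exact: normal_cst_integrable.
have ia : N.-integrable setT (EFin \o (fun x => w a * cos (c a + t a * x))).
  have := integrableZl measurableT (w a) (normal_cos_integrable (c a) (t a)).
  by apply: eq_integrable => // x _ /=; rewrite EFinM.
have E : (fun x => \sum_(a <- a :: l) w a * cos (c a + t a * x)) =
  (fun x => w a * cos (c a + t a * x) + \sum_(a <- l) w a * cos (c a + t a * x)).
  by apply/funext => x; rewrite big_cons.
rewrite E big_cons; split.
  have := integrableD measurableT ia il.
  by apply: eq_integrable => // x _ /=; rewrite EFinD.
rewrite (RintegralD measurableT ia il) El; congr (_ + _).
by rewrite (RintegralZl (w a) measurableT (normal_cos_integrable _ _)) normal_cf.
Qed.

End normal_characteristic_function.

Section gaussian_iteration.
Variables (R : realType) (p : nat).
Set Implicit Arguments. Unset Strict Implicit.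
Let N := @normal_prob R 0 1.

Definition normal_second_moment : R := Rintegral N setT (fun x => x ^+ 2).

Lemma normal_second_moment_ge0 : 0 <= normal_second_moment.
Proof. by apply: Rintegral_ge0 => x _; exact: sqr_ge0. Qed.

(** Integrating out coordinate k turns the frequency [th a k] into a factor exp(- th^2 / 2) and
    z_k^2 into its mean, while the error keeps its shape. The claim is made for all values of the
    remaining coordinates, so that it can serve as the pointwise bound for the next integral. *)
Lemma gauss_iter_sandwich (I : Type) (l : seq I) (w c : I -> R)
    (th : I -> nat -> R) (e C : R) (g : (nat -> R) -> R) :
  (forall z, `|g z - \sum_(a <- l) w a * cos (c a + \sum_(0 <= i < p) th a i * z i)|
      <= e + C * \sum_(0 <= i < p) z i ^+ 2) ->
  forall k z, (k <= p)%N ->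
  `|gauss_iter k g z - \sum_(a <- l) w a *
      (expR (- (\sum_(0 <= i < k) th a i ^+ 2) / 2)
        * cos (c a + \sum_(k <= i < p) th a i * z i))|
  <= e + C * (k%:R * normal_second_moment + \sum_(k <= i < p) z i ^+ 2).
Proof.
move=> hg; elim=> [|k ih] z kp /=.
  rewrite mul0r add0r; under eq_bigr do rewrite big_geq// oppr0 mul0r expR0 mul1r.
  exact: hg.
have rest (u : nat -> R -> R) t : \sum_(k <= i < p) u i (upd z k t i) =
    u k t + \sum_(k.+1 <= i < p) u i (z i).
  rewrite big_ltn// upd_same; congr (_ + _); apply: eq_big_nat => i /andP[ki _].
  by rewrite /upd gtn_eqF.
pose S := \sum_(k.+1 <= i < p) z i ^+ 2.
pose ww a := w a * expR (- (\sum_(0 <= i < k) th a i ^+ 2) / 2).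
pose cc a := c a + \sum_(k.+1 <= i < p) th a i * z i.
have [iB EB] := normal_cos_sum l ww cc (th ^~ k).
have iD0 : N.-integrable setT (EFin \o (fun=> e + C * (k%:R * normal_second_moment + S))).
  exact: normal_cst_integrable.
have iD1 : N.-integrable setT (EFin \o (fun x : R => C * x ^+ 2)).
  have := integrableZl measurableT C (normal_sqr_integrable R).
  by apply: eq_integrable => // x _ /=; rewrite EFinM.
have iD : N.-integrable setT
    (EFin \o (fun x : R => (e + C * (k%:R * normal_second_moment + S)) + C * x ^+ 2)).
  have := integrableD measurableT iD0 iD1.
  by apply: eq_integrable => // x _ /=; rewrite EFinD.
have key x : `|gauss_iter k g (upd z k x)
    - \sum_(a <- l) ww a * cos (cc a + th a k * x)|
    <= (e + C * (k%:R * normal_second_moment + S)) + C * x ^+ 2.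
  have := ih (upd z k x) (ltnW kp).
  rewrite (rest (fun _ t => t ^+ 2)) -/S.
  have -> : \sum_(a <- l) w a *
      (expR (- (\sum_(0 <= i < k) th a i ^+ 2) / 2) *
       cos (c a + \sum_(k <= i < p) th a i * upd z k x i)) =
     \sum_(a <- l) ww a * cos (cc a + th a k * x).
    apply: eq_bigr => a _; rewrite (rest (fun i t => th a i * t)) /ww mulrA.
    by rewrite /cc -addrA [_ + th a k * x]addrC.
  by move/le_trans; apply; lra.
have := Rintegral_sandwich iB iD key.
rewrite EB (RintegralD measurableT iD0 iD1) Rintegral_normal_cst.
rewrite (RintegralZl C measurableT (normal_sqr_integrable R)).
rewrite -/normal_second_moment.
have -> : \sum_(a <- l) ww a * (expR (- th a k ^+ 2 / 2) * cos (cc a)) =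
  \sum_(a <- l) w a * (expR (- (\sum_(0 <= i < k.+1) th a i ^+ 2) / 2)
        * cos (c a + \sum_(k.+1 <= i < p) th a i * z i)).
  apply: eq_bigr => a _; rewrite /ww -/(cc a) big_nat_recr//= opprD mulrDl expRD.
  by rewrite !mulrA.
move/le_trans; apply; rewrite -/S -natr1; lra.
Qed.

End gaussian_iteration.

(** * Expectations of functions of the responses as finite sums *)

Section bernoulli_expectation.
Context d (T : measurableType d) (R : realType) (P : probability T R).
Set Implicit Arguments. Unset Strict Implicit.
Variables (Y : nat -> T -> R) (q : nat -> R).
Hypothesis mY : forall i, measurable_fun setT (Y i).
Hypothesis Y01 : forall i w, Y i w = 0 \/ Y i w = 1.
Hypothesis PY : forall i, P (Y i @^-1` [set 1]) = (q i)%:E.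
Hypothesis indY : mutually_independent_rv P Y.

Definition depends_below n (G : (nat -> R) -> R) :=
  forall y z, (forall j, (j < n)%N -> y j = z j) -> G y = G z.

(** With success probabilities equal to 0 or 1 the mean is degenerate. This writes any function of
    finitely many responses as a polynomial in them, which gives its measurability and
    boundedness. *)
Lemma bern_mean_eval w k (G : (nat -> R) -> R) y :
  bern_mean (Y ^~ w) k G y = G (fun j => if (j < k)%N then Y j w else y j).
Proof.
elim: k y => [|k ih] y //=; rewrite !ih.
have E (b : R) : Y k w = b ->
    (fun j => if (j < k)%N then Y j w else upd y k b j) =
    (fun j => if (j < k.+1)%N then Y j w else y j).
  move=> Yb; apply/funext => j; rewrite /upd ltnS [(j <= k)%N]leq_eqVlt.
  by case: eqVneq => [->|_] //=; rewrite ltnn Yb.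
case: (Y01 k w) => Yk; rewrite (E _ Yk) Yk.
  by rewrite mul0r add0r subr0 mul1r.
by rewrite mul1r subrr mul0r addr0.
Qed.

Lemma bern_mean_measurable k G y :
  measurable_fun setT (fun w => bern_mean (Y ^~ w) k G y).
Proof.
elim: k y => [|k ih] y /=; first exact: measurable_cst.
apply: measurable_funD; apply: measurable_funM => //.
by apply: measurable_funB => //; exact: measurable_cst.
Qed.

Lemma bern_mean_bounded k G y :
  exists C : R, forall w, `|bern_mean (Y ^~ w) k G y| <= C.
Proof.
elim: k y => [|k ih] y /=; first by exists `|G y|.
have [C1 h1] := ih (upd y k 1); have [C0 h0] := ih (upd y k 0).
exists (C1 + C0) => w; apply: le_trans (ler_normD _ _) _.
rewrite !normrM; apply: lerD; case: (Y01 k w) => ->.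
- by rewrite normr0 mul0r (le_trans _ (h1 w)).
- by rewrite normr1 mul1r.
- by rewrite subr0 normr1 mul1r.
- by rewrite subrr normr0 mul0r (le_trans _ (h0 w)).
Qed.

Variables (n : nat) (G : (nat -> R) -> R).
Hypothesis hG : depends_below n G.
Let GY w := G (Y ^~ w).

Let GYE : GY = (fun w => bern_mean (Y ^~ w) n G (fun=> 0)).
Proof.
apply/funext => w; rewrite bern_mean_eval; apply: hG => j jn.
by rewrite jn.
Qed.

Lemma bern_integrable : P.-integrable setT (EFin \o GY).
Proof.
rewrite GYE; apply: measurable_bounded_integrable => //.
- exact: le_lt_trans (probability_le1 P measurableT) (ltry _).
- exact: bern_mean_measurable.
- have [C hC] := bern_mean_bounded n G (fun=> 0).
  exists C; split; first exact: num_real.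
  by move=> x Cx w _ /=; exact: le_trans (hC w) (ltW Cx).
Qed.

Let A k (y : nat -> R) : set T :=
  [set w | forall i, i \in index_iota k n -> [set y i] (Y i w)].

Let mpre i (b : R) : measurable (Y i @^-1` [set b]).
Proof. by rewrite -[X in measurable X]setTI; apply: mY => //; exact: measurable_set1. Qed.

Let mA k y : measurable (A k y).
Proof.
rewrite (_ : A k y = \bigcap_i (if i \in index_iota k n
    then Y i @^-1` [set y i] else setT)); last first.
  apply/seteqP; split => [w Aw i _|w h i ik].
    by case: ifPn => // ik; exact: Aw.
  by have := h i I; rewrite ik.
apply: bigcapT_measurable => i; case: ifP => _ //.
Qed.

Let PA k y (b : R) : (k < n)%N ->
  P (A k (upd y k b)) = (P (Y k @^-1` [set b]) * P (A k.+1 y))%E.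
Proof.
move=> kn; rewrite (indY (B := fun i => [set upd y k b i])) ?iota_uniq//.
rewrite (indY (B := fun i => [set y i])) ?iota_uniq//.
rewrite /index_iota (_ : (n - k = (n - k.+1).+1)%N); last by rewrite subnSK.
rewrite /= big_cons upd_same; congr (_ * _)%E.
rewrite !big_seq; apply: eq_bigr => i; rewrite mem_iota => /andP[ki _].
by rewrite /upd gtn_eqF.
Qed.

Let PY0 i : P (Y i @^-1` [set 0]) = (1 - q i)%:E.
Proof.
rewrite (_ : Y i @^-1` [set 0] = ~` (Y i @^-1` [set 1])); last first.
  apply/seteqP; split => w /=; first by move=> ->; apply/eqP; rewrite eq_sym oner_eq0.
  by case: (Y01 i w).
by rewrite probability_setC// PY EFinB.
Qed.

Let AU k y : (k < n)%N -> A k.+1 y = A k (upd y k 1) `|` A k (upd y k 0).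
Proof.
move=> kn.
have sub (b : R) : A k (upd y k b) `<=` A k.+1 y.
  move=> w h i; rewrite mem_index_iota => /andP[ki i_n].
  by have := h i; rewrite mem_index_iota (ltnW ki) i_n /upd gtn_eqF//; apply.
apply/seteqP; split => [w h|w [/sub|/sub]//].
have up (b : R) : Y k w = b -> A k (upd y k b) w.
  move=> Yb i; rewrite mem_index_iota => /andP[ki i_n] /=.
  rewrite /upd; case: eqVneq => [->//|ik]; apply: h.
  by rewrite mem_index_iota i_n ltn_neqAle eq_sym ik ki.
by case: (Y01 k w) => Yk; [right|left]; exact: up.
Qed.

(** Splitting [A k.+1 y] by the value of response k reproduces one step of the recursion of
    [bern_mean], independence supplying the weights. At k = 0 the first n responses are all
    prescribed and the integrand is constant; at k = n the event is the whole space. *)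
Let integral_A k y : (k <= n)%N ->
  (\int[P]_(w in A k y) (GY w)%:E = P (A k y) * (bern_mean q k G y)%:E)%E.
Proof.
elim: k y => [|k ih] y kn /=.
  rewrite (eq_integral (fun=> (G y)%:E)); last first.
    move=> w; rewrite inE => Aw; congr EFin; apply: hG => j jn.
    by apply: Aw; rewrite mem_index_iota.
  by rewrite integral_cst// muleC.
have iA k' y' : P.-integrable (A k' y') (EFin \o GY).
  by apply: integrableS bern_integrable.
rewrite (AU y kn) integral_setU_EFin//; first last.
- apply/disj_set2P/seteqP; split => // w [/(_ k) h1 /(_ k) h0].
  have kI : k \in index_iota k n by rewrite mem_index_iota leqnn.
  by have := h1 kI; have := h0 kI => /=; rewrite !upd_same => -> /eqP; rewrite eq_sym oner_eq0.
- by rewrite -(AU y kn); have /integrableP[/measurable_EFinP] := iA k.+1 y.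
rewrite -(AU y kn) !(ih _ (ltnW kn)) !(PA _ _ kn) PY PY0.
have : P (A k.+1 y) \is a fin_num by exact: fin_num_measure.
case: (P (A k.+1 y)) => //= r _.
by rewrite -!EFinM -EFinD; congr EFin; ring.
Qed.

Lemma bern_expectation y : Rintegral P setT GY = bern_mean q n G y.
Proof.
have := @integral_A n y (leqnn n).
have -> : A n y = setT.
  by apply/seteqP; split => // w _ i; rewrite mem_index_iota leqNgt andNb.
by rewrite /Rintegral [P setT]probability_setT mul1e => ->.
Qed.

End bernoulli_expectation.

(** * Concavity of the log-likelihood and localisation of its maximiser *)

Section euclidean.
Variables (R : realType) (p : nat).
Set Implicit Arguments. Unset Strict Implicit.
Implicit Types (u v w h : 'cV[R]_p).

Lemma dotv_ge0 u : 0 <= dotv u u.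
Proof. by rewrite dotvE; apply: sumr_ge0 => i _; rewrite -expr2 sqr_ge0. Qed.

Lemma eucl_norm_sqr u : eucl_norm u ^+ 2 = dotv u u.
Proof.
rewrite sqr_sqrtr ?dotvE; first by apply: eq_bigr => i _; rewrite expr2.
by apply: sumr_ge0 => i _; exact: sqr_ge0.
Qed.

Lemma eucl_norm_ge0 u : 0 <= eucl_norm u.
Proof. exact: sqrtr_ge0. Qed.

Lemma dotvZl a u v : dotv (a *: u) v = a * dotv u v.
Proof. by rewrite !dotvE mulr_sumr; apply: eq_bigr => i _; rewrite mxE mulrA. Qed.

Lemma dotvZr a u v : dotv u (a *: v) = a * dotv u v.
Proof. by rewrite dotvC dotvZl dotvC. Qed.

Lemma dotvDr u v w : dotv u (v + w) = dotv u v + dotv u w.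
Proof. by rewrite dotvC dotvDl !(dotvC _ u). Qed.

Lemma dotvBl u v w : dotv (u - v) w = dotv u w - dotv v w.
Proof. by rewrite dotvDl dotvNl. Qed.

Lemma dotv_sumr (I : Type) (r : seq I) (F : I -> 'cV[R]_p) u :
  dotv u (\sum_(i <- r) F i) = \sum_(i <- r) dotv u (F i).
Proof.
elim/big_rec2: _ => [|i a b _ <-]; first by rewrite dotvC dotv0l.
by rewrite dotvDr.
Qed.

Lemma ler_coord_eucl u i : `|u i ord0| <= eucl_norm u.
Proof.
rewrite -[leLHS]ger0_norm// -ler_sqr ?nnegrE ?eucl_norm_ge0//.
rewrite eucl_norm_sqr normr_id real_normK ?num_real// dotvE (bigD1 i)//= expr2.
by rewrite lerDl; apply: sumr_ge0 => j _; rewrite -expr2 sqr_ge0.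
Qed.

Lemma cauchy_schwarz u v : `|dotv u v| <= eucl_norm u * eucl_norm v.
Proof.
rewrite -ler_sqr ?nnegrE ?mulr_ge0 ?eucl_norm_ge0//.
rewrite exprMn !eucl_norm_sqr real_normK ?num_real//.
have [v0|] := eqVneq (dotv v v) 0.
  suff -> : dotv u v = 0 by rewrite expr0n/= v0 mulr0.
  rewrite dotvE big1// => i _.
  have := ler_coord_eucl v i; rewrite -ler_sqr ?nnegrE ?eucl_norm_ge0//.
  rewrite eucl_norm_sqr v0 => h.
  have : `|v i ord0| ^+ 2 = 0 by apply/eqP; rewrite eq_le h sqr_ge0.
  by move/eqP; rewrite expf_eq0/= normr_eq0 => /eqP ->; rewrite mulr0.
move=> vn; have v0 : 0 < dotv v v by rewrite lt_neqAle eq_sym vn dotv_ge0.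
have := dotv_ge0 (dotv v v *: u - dotv u v *: v).
rewrite dotvBl !dotvBr !dotvZl !dotvZr (dotvC v u).
set a := dotv u u; set b := dotv v v in v0 *; set c := dotv u v => h.
rewrite -subr_ge0 -(pmulr_rge0 _ v0).
by apply: le_trans h _; rewrite le_eqVlt; apply/orP; left; apply/eqP; ring.
Qed.

Lemma eucl_normZ a u : eucl_norm (a *: u) = `|a| * eucl_norm u.
Proof.
apply/eqP; rewrite -(@eqrXn2 _ 2) ?mulr_ge0 ?eucl_norm_ge0//.
by rewrite exprMn !eucl_norm_sqr dotvZl dotvZr real_normK ?num_real// expr2 mulrA.
Qed.

Lemma ler_eucl_normD u v : eucl_norm (u + v) <= eucl_norm u + eucl_norm v.
Proof.
rewrite -ler_sqr ?nnegrE ?addr_ge0 ?eucl_norm_ge0//.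
rewrite sqrrD !eucl_norm_sqr dotvDl !dotvDr (dotvC v u).
have := cauchy_schwarz u v; rewrite ler_norml; lra.
Qed.

Lemma eucl_norm_le_sum (u : 'cV[R]_p) (L : R) : 0 <= L ->
  (forall j, `|u j ord0| <= L) -> eucl_norm u <= p%:R * L.
Proof.
move=> L0 uL; rewrite -ler_sqr ?nnegrE ?eucl_norm_ge0 ?mulr_ge0//.
rewrite eucl_norm_sqr dotvE; apply: (@le_trans _ _ (\sum_(j < p) L ^+ 2)).
  apply: ler_sum => j _; rewrite -expr2 -[leLHS]real_normK ?num_real//.
  by apply: lerXn2r; rewrite ?nnegrE.
rewrite sumr_const card_ord -[leLHS]mulr_natl exprMn; apply: ler_wpM2r; first exact: sqr_ge0.
by rewrite -natrX ler_nat; case: (p) => // k; rewrite leq_pmulr.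
Qed.

End euclidean.

(** * The log-likelihood ratio in coordinates whitened by the information matrix *)

Section logistic_score.
Variables (R : realType) (p n : nat).
Set Implicit Arguments. Unset Strict Implicit.
Variables (q y : nat -> R) (v : nat -> 'cV[R]_p) (M : R).
Hypothesis q01 : forall i, 0 <= q i <= 1.
Hypothesis isotropic : forall h, \sum_(i < n) q i * (1 - q i) * dotv h (v i) ^+ 2
  = dotv h h.
Hypothesis vM : forall i, (i < n)%N -> eucl_norm (v i) <= M.
Implicit Types h : 'cV[R]_p.

(** The one small quantity of the proof: it controls both the Taylor remainder of the log-likelihood
    and the total error of the Lindeberg swaps. *)
Definition cubic_moment : R := \sum_(i < n) q i * (1 - q i) * eucl_norm (v i) ^+ 3.

Definition score : 'cV[R]_p := \sum_(i < n) (y i - q i) *: v i.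

(* The log-likelihood ratio at [beta0 + J^{-1/2} h], with [v i = J^{-1/2} x_i]. *)
Definition loglik_ratio h : R :=
  \sum_(i < n) (y i * dotv h (v i) - ln (1 - q i + q i * expR (dotv h (v i)))).

Lemma q1q_ge0 i : 0 <= q i * (1 - q i).
Proof. by have /andP[a b] := q01 i; rewrite mulr_ge0// subr_ge0. Qed.

(** Isotropy tested on the unit vectors and summed: the trace of the identity. *)
Lemma isotropic_trace : \sum_(i < n) q i * (1 - q i) * dotv (v i) (v i) = p%:R.
Proof.
under eq_bigr do rewrite dotvE mulr_sumr; rewrite exchange_big/=.
transitivity (\sum_(j < p) (1 : R)); last by rewrite sumr_const card_ord.
apply: eq_bigr => j _.
have e w : dotv (delta_mx j ord0) w = w j ord0 :> R.
  rewrite dotvE (bigD1 j)//= big1 ?addr0 => [|i ij].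
    by rewrite mxE !eqxx mul1r.
  by rewrite mxE (negbTE ij) mul0r.
transitivity (\sum_(i < n) q i * (1 - q i) * dotv (delta_mx j ord0) (v i) ^+ 2).
  by apply: eq_bigr => i _; rewrite e expr2.
by rewrite isotropic e mxE !eqxx.
Qed.

(** The first-order terms assemble into the score and the second-order ones into |h|^2 / 2 by
    isotropy. The factor exp(M r) comes from |h'v_i| <= M r, the range on which the cumulant
    expansion is used. *)
Lemma loglik_ratio_quadratic h r : 0 <= M -> eucl_norm h <= r ->
  `|loglik_ratio h - (dotv h score - dotv h h / 2)|
  <= expR (M * r) * cubic_moment * r ^+ 3.
Proof.
move=> M0 hr.
have -> : loglik_ratio h - (dotv h score - dotv h h / 2) =
  - \sum_(i < n) (ln (1 - q i + q i * expR (dotv h (v i)))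
      - q i * dotv h (v i) - q i * (1 - q i) * dotv h (v i) ^+ 2 / 2).
  rewrite -isotropic /score dotv_sumr /loglik_ratio.
  rewrite mulr_suml -!sumrB -sumrN; apply: eq_bigr => i _.
  by rewrite dotvZr; ring.
rewrite normrN; apply: le_trans (ler_norm_sum _ _ _) _.
rewrite /cubic_moment mulr_sumr mulr_suml; apply: ler_sum => i _.
have t1 : `|dotv h (v i)| <= r * eucl_norm (v i).
  apply: le_trans (cauchy_schwarz _ _) _; apply: ler_wpM2r => //.
  exact: eucl_norm_ge0.
have t2 : `|dotv h (v i)| <= M * r.
  apply: le_trans t1 _; rewrite mulrC; apply: ler_wpM2r; last exact: vM.
  exact: le_trans (eucl_norm_ge0 _) hr.
apply: le_trans (ln_bernoulli_mgf_approx (q01 i) t2) _.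
have -> : expR (M * r) * (q i * (1 - q i) * eucl_norm (v i) ^+ 3) * r ^+ 3 =
  q i * (1 - q i) * expR (M * r) * (r * eucl_norm (v i)) ^+ 3 by ring.
apply: ler_wpM2l; first by rewrite mulr_ge0 ?q1q_ge0 ?expR_ge0.
by apply: lerXn2r; rewrite ?nnegrE// (le_trans _ t1).
Qed.

(** Both end points are compared with the tangent of the cumulant function at the intermediate
    point; in the weighted average the slope terms cancel. *)
Lemma loglik_ratio_concave h h' a : 0 <= a <= 1 ->
  (1 - a) * loglik_ratio h + a * loglik_ratio h'
  <= loglik_ratio ((1 - a) *: h + a *: h').
Proof.
move=> /andP[a0 a1]; rewrite /loglik_ratio !mulr_sumr -big_split/=.
apply: ler_sum => i _; rewrite dotvDl !dotvZl.
set s := dotv h (v i); set t := dotv h' (v i).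
set z := (1 - a) * s + a * t.
have h1 := ln_bernoulli_mgf_tangent z s (q01 i).
have h2 := ln_bernoulli_mgf_tangent z t (q01 i).
move: h1 h2; set Lz := ln (_ + q i * expR z); set Ls := ln (_ + q i * expR s).
set Lt := ln (_ + q i * expR t); set D := _ / _ => h1 h2.
have b0 : 0 <= 1 - a by rewrite subr_ge0.
have k1 := ler_wpM2l b0 h1; have k2 := ler_wpM2l a0 h2.
have E : (1 - a) * (Lz + D * (s - z)) + a * (Lz + D * (t - z)) = Lz.
  by rewrite /z; ring.
have := lerD k1 k2; rewrite E => k.
rewrite (_ : (1 - a) * (y i * s - Ls) + a * (y i * t - Lt) =
  y i * z - ((1 - a) * Ls + a * Lt)); last by rewrite /z; ring.
by rewrite lerD2l lerN2.
Qed.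

Lemma continuous_loglik_ratio :
  continuous (fun z : 'rV[R]_p => loglik_ratio z^T).
Proof.
have cd i : continuous (fun z : 'rV[R]_p => dotv z^T (v i)).
  rewrite (_ : (fun z : 'rV[R]_p => dotv z^T (v i)) =
     (fun z : 'rV[R]_p => \sum_(j < p) z ord0 j * v i j ord0)); last first.
    by apply/funext => z'; rewrite dotvE; apply: eq_bigr => j _; rewrite mxE.
  apply: (continuous_big add_continuous) => j _ z.
  apply: (@continuous_comp _ _ _ (fun z : 'rV[R]_p => z ord0 j) ( *%R^~ (v i j ord0))).
    exact: coord_continuous.
  exact: mulrr_continuous.
apply: (continuous_big add_continuous) => i _ z.
apply: (@continuous_comp _ _ _ (fun z : 'rV[R]_p => dotv z^T (v i))
   (fun t : R => y i * t - ln (1 - q i + q i * expR t))); first exact: cd.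
set s := dotv z^T (v i).
have D0 := bernoulli_mgf_gt0 s (q01 i).
have dD : is_derive s 1 (fun t : R => 1 - q i + q i * expR t) (q i * expR s).
  by apply: is_derive_eq; rewrite /GRing.scale/=; ring.
have dL : is_derive s 1 (fun t : R => ln (1 - q i + q i * expR t)) _ :=
  @is_derive1_comp _ (@ln R) (fun t : R => 1 - q i + q i * expR t) s _ _
    (is_derive1_ln D0) dD.
apply/differentiable_continuous/derivable1_diffP.
by apply: derivableB => //; have [] := dL.
Qed.

Section localisation.
Variables (r dl : R).
Hypothesis M0 : 0 <= M.
Hypothesis dl0 : 0 < dl.
Hypothesis scorer : eucl_norm score + dl <= r.
Hypothesis small : expR (M * r) * cubic_moment * r ^+ 3 <= dl ^+ 2 / 8.

Let complete_square h : dotv h score - dotv h h / 2 =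
  dotv score score / 2 - dotv (h - score) (h - score) / 2.
Proof. by rewrite !dotvBl !dotvBr (dotvC score h); field. Qed.

(** The quadratic model drops by dl^2 / 2 from the score to the sphere, whereas the remainders at
    the two points cost at most dl^2 / 8 each. The radius [r] is large enough to contain both
    points. *)
Let sphere h : eucl_norm (h - score) = dl -> loglik_ratio h < loglik_ratio score.
Proof.
move=> hd.
have hr : eucl_norm h <= r.
  rewrite -(subrK score h); apply: le_trans (ler_eucl_normD _ _) _.
  by rewrite hd addrC.
have sr : eucl_norm score <= r by apply: le_trans scorer; rewrite lerDl ltW.
have := le_trans (loglik_ratio_quadratic M0 hr) small.
have := le_trans (loglik_ratio_quadratic M0 sr) small.
rewrite (complete_square h) -(eucl_norm_sqr (h - score)) hd.
set a := loglik_ratio h; set b := loglik_ratio score.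
rewrite !ler_norml; have := exprn_gt0 2 dl0.
lra.
Qed.

(** If an outer point did at least as well as the score, concavity would make the point where the
    segment between them crosses the sphere do so too. *)
Lemma loglik_ratio_outside h : dl < eucl_norm (h - score) ->
  loglik_ratio h < loglik_ratio score.
Proof.
move=> hd; rewrite ltNge; apply/negP => le_sh.
have d0 : 0 < eucl_norm (h - score) by exact: lt_trans hd.
pose a := dl / eucl_norm (h - score).
have a01 : 0 <= a <= 1.
  by rewrite /a divr_ge0 ?(ltW dl0) ?(ltW d0)//= ler_pdivrMr// mul1r ltW.
have := loglik_ratio_concave score h a01.
have : loglik_ratio ((1 - a) *: score + a *: h) < loglik_ratio score.
  apply: sphere.
  have -> : (1 - a) *: score + a *: h - score = a *: (h - score).
    by rewrite scalerBl scale1r scalerBr; apply/matrixP => i j; rewrite !mxE; ring.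
  have /andP[a0 _] := a01.
  by rewrite eucl_normZ ger0_norm// /a divfK// gt_eqF.
have : 0 <= a * (loglik_ratio h - loglik_ratio score).
  by have /andP[a0 _] := a01; rewrite mulr_ge0// subr_ge0.
lra.
Qed.

(** A maximum over the compact cube of half-width [dl] around the score is global: a point outside
    the cube is outside the ball of radius [dl], hence worse than the score, which lies in the
    cube. *)
Lemma loglik_ratio_max_exists : exists b, forall h, loglik_ratio h <= loglik_ratio b.
Proof.
pose K := [set z : 'rV[R]_p | forall j,
  `[score^T ord0 j - dl, score^T ord0 j + dl]%classic (z ord0 j)].
have cK : compact K.
  exact: (@rV_compact R p
    (fun j => `[score^T ord0 j - dl, score^T ord0 j + dl]%classic)
    (fun=> @segment_compact _ _ _)).
have Ks : K score^T.
  by move=> j /=; rewrite in_itv/=; have := ltW dl0; lra.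
have K0 : K !=set0 by exists score^T.
have [b Kb hb] := compact_EVT_max K0 cK (continuous_subspaceT continuous_loglik_ratio).
exists b^T => h.
have [Kh|nKh] := pselect (K h^T).
  by rewrite -[h in leLHS]trmxK; apply: hb; rewrite inE.
have hs : loglik_ratio score <= loglik_ratio b^T.
  by rewrite -[score in leLHS]trmxK; apply: hb; rewrite inE.
apply: le_trans hs; apply/ltW/loglik_ratio_outside.
move: nKh => /existsNP[j] /=; rewrite in_itv/= => /negP nj.
apply: lt_le_trans (ler_coord_eucl (h - score) j).
rewrite ltNge; apply: contra nj; rewrite !mxE ler_norml; lra.
Qed.

Lemma loglik_ratio_argmax b : (forall h, loglik_ratio h <= loglik_ratio b) ->
  eucl_norm (b - score) <= dl.
Proof.
move=> hb; rewrite leNgt; apply/negP => /loglik_ratio_outside.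
by rewrite ltNge hb.
Qed.

End localisation.
End logistic_score.

(** * Convergence of the score and of the estimator *)

Section trigonometric_limits.
Variables (R : realType) (p : nat).
Set Implicit Arguments. Unset Strict Implicit.

(** The mean of [trig_eval l] under N_p{0, I_p}, read off from the characteristic function. *)
Definition trig_gauss (l : seq (R * 'cV[R]_p * R)) : R :=
  \sum_(a <- l) a.1.1 * (expR (- dotv a.1.2 a.1.2 / 2) * cos a.2).

Lemma std_normal_expect_trig (f : 'cV[R]_p -> R) l (e C : R) :
  (forall u, `|f u - trig_eval l u| <= e + C * \sum_(j < p) u j ord0 ^+ 2) ->
  `|std_normal_expect f - trig_gauss l| <= e + C * (p%:R * normal_second_moment R).
Proof.
move=> fl.
pose th (a : R * 'cV[R]_p * R) i : R := if insub i is Some j then a.1.2 j ord0 else 0.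
have thE a (F : R -> nat -> R) :
    \sum_(0 <= i < p) F (th a i) i = \sum_(j < p) F (a.1.2 j ord0) j.
  by rewrite big_mkord; apply: eq_bigr => j _; rewrite /th valK.
have := @gauss_iter_sandwich R p _ l (fun a => a.1.1) snd th e C
  (fun z => f (\col_(i < p) z i)) _ p (fun=> 0) (leqnn p).
rewrite [\sum_(p <= i < p) _]big_geq// addr0.
have -> : \sum_(a <- l) a.1.1 * (expR (- (\sum_(0 <= i < p) th a i ^+ 2) / 2)
    * cos (a.2 + \sum_(p <= i < p) th a i * 0)) = trig_gauss l.
  apply: eq_bigr => a _; rewrite (big_geq (leqnn p)) addr0.
  rewrite (thE a (fun t _ => t ^+ 2)) dotvE.
  by under eq_bigr do rewrite expr2.
apply=> z; have := fl (\col_(i < p) z i).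
rewrite big_mkord; under [X in _ <= e + C * X -> _]eq_bigr do rewrite mxE.
congr (`|_ - _| <= _); apply: eq_bigr => a _; congr (_ * cos (_ + _)).
rewrite (thE a (fun t i => t * z i)) dotvE.
by apply: eq_bigr => j _; rewrite mxE.
Qed.

(** Outside the cube some squared coordinate exceeds L^2, so the trivial bound 2 B is paid for by
    the quadratic term. Here [d] stands for the discrepancy between the test function and its
    approximation. *)
Lemma tail_bound (L e B d : R) (u : 'cV[R]_p) : 0 < L -> 0 <= e -> d <= 2 * B ->
  ((forall j, `|u j ord0| <= L) -> d <= e) -> 0 <= B ->
  d <= e + 2 * B / L ^+ 2 * \sum_(j < p) u j ord0 ^+ 2.
Proof.
move=> L0 e0 dB ud B0.
have S0 : 0 <= \sum_(j < p) u j ord0 ^+ 2.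
  by apply: sumr_ge0 => j _; exact: sqr_ge0.
have C0 : 0 <= 2 * B / L ^+ 2 by rewrite divr_ge0 ?sqr_ge0// mulr_ge0.
have [H|/existsNP[j /negP]] := pselect (forall j, `|u j ord0| <= L).
  by rewrite -[leLHS]addr0; apply: lerD; [exact: ud|exact: mulr_ge0].
rewrite -ltNge => Lj; rewrite -[leLHS]add0r; apply: lerD => //.
apply: le_trans dB _; rewrite mulrAC ler_pdivlMr ?exprn_gt0//.
apply: ler_wpM2l; first exact: mulr_ge0.
rewrite (bigD1 j)//= -[leLHS]addr0; apply: lerD.
  rewrite -[leRHS]real_normK ?num_real//.
  by apply: lerXn2r; rewrite ?nnegrE ?(ltW L0)// ltW.
by apply: sumr_ge0 => i _; exact: sqr_ge0.
Qed.

Variables (n : nat) (q : nat -> R) (v : nat -> 'cV[R]_p) (M : R).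
Hypothesis q01 : forall i, 0 <= q i <= 1.
Hypothesis isotropic : forall h, \sum_(i < n) q i * (1 - q i) * dotv h (v i) ^+ 2
  = dotv h h.
Hypothesis vM : forall i, (i < n)%N -> eucl_norm (v i) <= M.

(** The factor of the cubic moment in the Lindeberg error. It depends on the polynomial and on [M],
    which bounds all |v_i|, but not on n. *)
Definition trig_weight (l : seq (R * 'cV[R]_p * R)) : R :=
  \sum_(a <- l) `|a.1.1| * (eucl_norm a.1.2 ^+ 3 + M * eucl_norm a.1.2 ^+ 4).

Lemma bern_mean_cos_score (th : 'cV[R]_p) (ph : R) y0 :
  `|bern_mean q n (fun y => cos (ph + dotv th (score n q y v))) y0
     - expR (- dotv th th / 2) * cos ph|
  <= cubic_moment n q v * (eucl_norm th ^+ 3 + M * eucl_norm th ^+ 4).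
Proof.
have E y : cos (ph + dotv th (score n q y v)) =
    cos (ph + \sum_(i < n) (y i - q i) * dotv th (v i)).
  rewrite /score dotv_sumr; congr (cos (_ + _)).
  by apply: eq_bigr => i _; rewrite dotvZr.
rewrite (eq_bern_mean _ _ _ E).
have := @bern_mean_cos R q n (fun i => dotv th (v i)) (fun=> ph) y0 q01 (fun _ _ _ => erefl).
rewrite isotropic => /le_trans; apply.
rewrite mulr_suml; apply: ler_sum => i _.
rewrite -[leLHS]mulrA -[leRHS]mulrA; apply: ler_wpM2l; first exact: q1q_ge0.
have vi := vM (ltn_ord i); have v0 := eucl_norm_ge0 (v i).
have t0 := eucl_norm_ge0 th; have cs := cauchy_schwarz th (v i).
set s := dotv th (v i) in cs *; set a := eucl_norm th in t0 cs *.
set b := eucl_norm (v i) in v0 vi cs *.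
have -> : s ^+ 2 = `|s| ^+ 2 by rewrite real_normK ?num_real.
have ab0 : 0 <= a * b by rewrite mulr_ge0.
apply: (@le_trans _ _ ((a * b) ^+ 2 * (a * b + (a * b) ^+ 2))).
  apply: ler_pM; rewrite ?sqr_ge0 ?addr_ge0 ?sqr_ge0//.
    by apply: lerXn2r; rewrite ?nnegrE.
  by apply: lerD => //; apply: lerXn2r; rewrite ?nnegrE.
have -> : (a * b) ^+ 2 * (a * b + (a * b) ^+ 2) =
  b ^+ 3 * (a ^+ 3 + b * a ^+ 4) by ring.
apply: ler_wpM2l; first exact: exprn_ge0.
by rewrite lerD2l; apply: ler_wpM2r; first exact: exprn_ge0.
Qed.

Lemma bern_mean_trig l y0 :
  `|bern_mean q n (fun y => trig_eval l (score n q y v)) y0 - trig_gauss l|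
  <= cubic_moment n q v * trig_weight l.
Proof.
rewrite /trig_eval bern_mean_sum /trig_gauss -sumrB /trig_weight mulr_sumr.
apply: le_trans (ler_norm_sum _ _ _) _; apply: ler_sum => a _.
rewrite bern_meanZ -mulrBr normrM mulrCA; apply: ler_wpM2l => //.
exact: bern_mean_cos_score.
Qed.

(** The score has identity covariance, so its mean squared length is p for every n; this is what
    makes the tail term uniform in n. *)
Lemma bern_mean_score_sqr y0 :
  bern_mean q n (fun y => \sum_(j < p) score n q y v j ord0 ^+ 2) y0 = p%:R.
Proof.
rewrite bern_mean_sum -(isotropic_trace isotropic).
under [RHS]eq_bigr do rewrite dotvE mulr_sumr.
rewrite [RHS]exchange_big/=; apply: eq_bigr => j _.
have E y : score n q y v j ord0 ^+ 2 =
    (0 + \sum_(i < n) (y i - q i) * v i j ord0) ^+ 2.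
  by rewrite /score summxE add0r; under eq_bigr do rewrite mxE.
rewrite (eq_bern_mean _ _ _ E).
rewrite (@bern_mean_sqr R q n (fun i => v i j ord0) (fun=> 0) y0)//.
by rewrite expr0n/= add0r; apply: eq_bigr => i _; rewrite expr2.
Qed.

(** One factor |v_i| is bounded by [e] when it is below [e], the rest summing to at most p by the
    trace identity, and by [M] otherwise. *)
Lemma cubic_moment_le (e : R) : 0 <= e -> 0 <= M ->
  cubic_moment n q v <= e * p%:R + M * \sum_(i < n) q i * (1 - q i)
     * dotv (v i) (v i) * (if e <= eucl_norm (v i) then 1 else 0).
Proof.
move=> e0 M0; rewrite -(isotropic_trace isotropic) !mulr_sumr -big_split/=.
apply: ler_sum => i _; rewrite -eucl_norm_sqr.
have c0 := q1q_ge0 q01 i; set c := q i * (1 - q i) in c0 *.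
have v0 := eucl_norm_ge0 (v i); have vi := vM (ltn_ord i).
set b := eucl_norm (v i) in v0 vi *.
have b2 : 0 <= c * b ^+ 2 by rewrite mulr_ge0// sqr_ge0.
rewrite exprS; case: (leP e b) => eb.
  rewrite mulr1; apply: (@le_trans _ _ (M * (c * b ^+ 2))).
    by rewrite mulrCA; apply: ler_wpM2r.
  by rewrite lerDr mulr_ge0.
rewrite mulr0 mulr0 addr0 mulrCA; apply: ler_wpM2r => //; exact: ltW.
Qed.

End trigonometric_limits.

(** * Whitening by the symmetric square root of the information matrix *)

Section information_square_root.
Variables (R : realType) (p n : nat).
Set Implicit Arguments. Unset Strict Implicit.
Variables (x : nat -> 'cV[R]_p) (c : nat -> R) (S : 'M[R]_p).
Let J := \sum_(i < n) c i *: (x i *m (x i)^T).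
Hypothesis uJ : J \in unitmx.
Hypothesis sqrtS : is_sym_sqrt S J.

Lemma sym_sqrt_unit : S \in unitmx.
Proof.
by have [_ [_ SS]] := sqrtS; move: uJ; rewrite -SS unitmx_mul => /andP[].
Qed.

Lemma dotv_mulmx (B : 'M[R]_p) (g h : 'cV[R]_p) :
  dotv (B *m g) h = dotv g (B^T *m h).
Proof. by rewrite /dotv trmx_mul mulmxA. Qed.

Lemma sym_sqrt_invT : (invmx S)^T = invmx S.
Proof. by have [sS _] := sqrtS; rewrite trmx_inv sS. Qed.

Lemma quadratic_form_J (g : 'cV[R]_p) :
  dotv g (J *m g) = \sum_(i < n) c i * dotv g (x i) ^+ 2.
Proof.
rewrite /J mulmx_suml dotv_sumr; apply: eq_bigr => i _.
rewrite -scalemxAl dotvZr; congr (_ * _).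
rewrite -mulmxA [(x i)^T *m g]mx11_scalar mul_mx_scalar dotvZr.
by rewrite -/(dotv (x i) g) dotvC expr2.
Qed.

Lemma sym_sqrt_isotropic (h : 'cV[R]_p) :
  \sum_(i < n) c i * dotv h (invmx S *m x i) ^+ 2 = dotv h h.
Proof.
have [sS [_ SS]] := sqrtS; have uS := sym_sqrt_unit.
transitivity (dotv (invmx S *m h) (J *m (invmx S *m h))).
  rewrite quadratic_form_J; apply: eq_bigr => i _; congr (_ * _ ^+ 2).
  by rewrite dotv_mulmx sym_sqrt_invT.
by rewrite dotv_mulmx sym_sqrt_invT -SS !mulmxA mulVmx// mul1mx mulmxV// mul1mx.
Qed.

(** Since J^{-1} = J^{-1/2} J^{-1/2}, the weights in the Lindeberg-type condition are the squared
    lengths of the whitened covariates. *)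
Lemma inv_quadratic_form (u : 'cV[R]_p) :
  (u^T *m invmx J *m u) ord0 ord0 = dotv (invmx S *m u) (invmx S *m u).
Proof.
have [sS [_ SS]] := sqrtS; have uS := sym_sqrt_unit.
have -> : invmx J = invmx S *m invmx S.
  have H : invmx S *m invmx S *m J = 1%:M.
    by rewrite -SS -mulmxA (mulmxA (invmx S) S) mulVmx// mul1mx mulVmx.
  by rewrite -[RHS]mulmx1 -(mulmxV uJ) mulmxA H mul1mx.
by rewrite dotv_mulmx sym_sqrt_invT /dotv !mulmxA.
Qed.

Lemma dotv_sqrt_inv (h u : 'cV[R]_p) : dotv (S *m h) (invmx S *m u) = dotv h u.
Proof.
have [sS _] := sqrtS.
by rewrite dotv_mulmx sS mulmxA mulmxV ?mul1mx// sym_sqrt_unit.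
Qed.

End information_square_root.

Section logistic_likelihood.
Variables (R : realType) (p : nat).
Set Implicit Arguments. Unset Strict Implicit.

Lemma logistic01 (t : R) : 0 < logistic t < 1.
Proof.
have e := expR_gt0 t; have e1 : 0 < 1 + expR t by rewrite addr_gt0.
by rewrite /logistic divr_gt0//= ltr_pdivrMr// mul1r; lra.
Qed.

Lemma ln_logistic (t : R) : ln (logistic t) = t - ln (1 + expR t).
Proof.
by rewrite /logistic ln_div ?posrE ?expR_gt0 ?addr_gt0 ?expR_gt0// expRK.
Qed.

Lemma onem_logistic (t : R) : 1 - logistic t = (1 + expR t)^-1.
Proof.
by rewrite /logistic; field; rewrite gt_eqF// addr_gt0 ?expR_gt0.
Qed.

Lemma ln_onem_logistic (t : R) : ln (1 - logistic t) = - ln (1 + expR t).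
Proof. by rewrite onem_logistic lnV// posrE addr_gt0 ?expR_gt0. Qed.

(** Exponential-family structure: moving the linear predictor from a to a + t multiplies 1 + e^a by
    the moment generating function at t of a Bernoulli variable with mean [logistic a]. *)
Lemma logistic_shift (y a t : R) :
  y * ln (logistic (a + t)) + (1 - y) * ln (1 - logistic (a + t)) =
  y * ln (logistic a) + (1 - y) * ln (1 - logistic a)
  + (y * t - ln (1 - logistic a + logistic a * expR t)).
Proof.
have e0 b : 0 < 1 + expR b :> R by rewrite addr_gt0 ?expR_gt0.
have -> : 1 - logistic a + logistic a * expR t = (1 + expR (a + t)) / (1 + expR a).
  by rewrite expRD /logistic; field; rewrite gt_eqF.
by rewrite ln_div ?posrE// !ln_logistic !ln_onem_logistic; ring.
Qed.

Lemma loglik_shift (x : nat -> 'cV[R]_p) n (b0 b : 'cV[R]_p) y (S : 'M[R]_p)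
    (c : nat -> R) (J := \sum_(i < n) c i *: (x i *m (x i)^T)) :
  J \in unitmx -> is_sym_sqrt S J ->
  loglik x n b y = loglik x n b0 y
   + loglik_ratio n (fun i => logistic (dotv b0 (x i))) y
       (fun i => invmx S *m x i) (S *m (b - b0)).
Proof.
move=> uJ sS; rewrite /loglik /loglik_ratio -big_split/=; apply: eq_bigr => i _.
rewrite (dotv_sqrt_inv uJ sS) -logistic_shift.
by have -> : dotv b0 (x i) + dotv (b - b0) (x i) = dotv b (x i)
  by rewrite -dotvDl addrC subrK.
Qed.

End logistic_likelihood.

(** * The error of the expectation at a fixed sample size *)

Section main_estimate.
Context (R : realType) (d : measure_display) (T : measurableType d).
Set Implicit Arguments. Unset Strict Implicit.
Variables (P : probability T R) (p n : nat) (q : nat -> R) (v : nat -> 'cV[R]_p).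
Variables (Y : nat -> T -> R) (Z : T -> 'cV[R]_p) (M : R).
Hypothesis mY : forall i, measurable_fun setT (Y i).
Hypothesis Y01 : forall i w, Y i w = 0 \/ Y i w = 1.
Hypothesis PY : forall i, P (Y i @^-1` [set 1]) = (q i)%:E.
Hypothesis indY : mutually_independent_rv P Y.
Hypothesis q01 : forall i, 0 <= q i <= 1.
Hypothesis isotropic : forall h, \sum_(i < n) q i * (1 - q i) * dotv h (v i) ^+ 2
  = dotv h h.
Hypothesis M0 : 0 <= M.
Hypothesis vM : forall i, (i < n)%N -> eucl_norm (v i) <= M.
Hypothesis Zmax : forall w,
  (exists b, forall h, loglik_ratio n q (Y ^~ w) v h <= loglik_ratio n q (Y ^~ w) v b) ->
  forall h, loglik_ratio n q (Y ^~ w) v h <= loglik_ratio n q (Y ^~ w) v (Z w).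

Lemma depends_below_score (G : 'cV[R]_p -> R) :
  depends_below n (fun y => G (score n q y v)).
Proof.
move=> y z yz; congr G; apply: eq_bigr => i _.
by rewrite yz.
Qed.

(** When the score lies in the cube of half-width [L], a maximiser exists and [Z] is within [dl] of
    the score: one [e] is spent on replacing [f] by the polynomial at [Z], another on moving from
    [Z] to the score. Off that cube the tail term pays, with mean squared score p. The cube for [f]
    has half-width L + 1 because [Z] may leave the first one by dl <= 1, and p L + 1 bounds the
    length of the score plus [dl]. *)
Lemma expectation_estimator_approx (f : 'cV[R]_p -> R) l (L B e dl C : R) :
  0 < L -> 0 <= e -> 0 <= B -> 0 < dl <= 1 -> C * dl <= e ->
  (forall u, `|f u| <= B) -> (forall u, `|trig_eval l u| <= B) ->
  (forall u : 'cV[R]_p, (forall j, `|u j ord0| <= L + 1) -> `|f u - trig_eval l u| <= e) ->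
  (forall (u w : 'cV[R]_p) (t : R), 0 <= t -> (forall i, `|u i ord0 - w i ord0| <= t) ->
     `|trig_eval l u - trig_eval l w| <= C * t) ->
  expR (M * (p%:R * L + 1)) * cubic_moment n q v * (p%:R * L + 1) ^+ 3
    <= dl ^+ 2 / 8 ->
  `|Rintegral P setT (f \o Z) - trig_gauss l|
  <= e + e + 2 * B / L ^+ 2 * p%:R + cubic_moment n q v * trig_weight M l.
Proof.
move=> L0 e0 B0 /andP[dl0 dl1] Cdl fB lB fl lip small.
pose U w := score n q (Y ^~ w) v.
have key w : `|(f \o Z) w - trig_eval l (U w)| <=
    e + e + 2 * B / L ^+ 2 * \sum_(j < p) U w j ord0 ^+ 2.
  apply: tail_bound => //; first by rewrite addr_ge0.
    by apply: le_trans (ler_normB _ _) _; have := fB (Z w); have := lB (U w) => /=; lra.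
  move=> UL.
  have Ur : eucl_norm (U w) + dl <= p%:R * L + 1.
    by apply: lerD => //; apply: eucl_norm_le_sum => //; exact: ltW.
  have ex := loglik_ratio_max_exists q01 isotropic vM M0 dl0 Ur small.
  have Zm := loglik_ratio_argmax q01 isotropic vM M0 dl0 Ur small (Zmax ex).
  have ZU i : `|Z w i ord0 - U w i ord0| <= dl.
    by have := ler_coord_eucl (Z w - U w) i; rewrite !mxE => /le_trans; apply.
  rewrite /= (_ : f (Z w) - trig_eval l (U w) = (f (Z w) - trig_eval l (Z w))
     + (trig_eval l (Z w) - trig_eval l (U w))); last by ring.
  apply: le_trans (ler_normD _ _) _; apply: lerD.
    apply: fl => j; rewrite -(subrK (U w j ord0) (Z w j ord0)).
    by apply: le_trans (ler_normD _ _) _; have := ZU j; have := UL j; lra.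
  by apply: le_trans Cdl; apply: lip => //; exact: ltW.
have dB := depends_below_score (trig_eval l).
have dD := depends_below_score (fun u => e + e + 2 * B / L ^+ 2 * \sum_(j < p) u j ord0 ^+ 2).
have iB := bern_integrable P mY Y01 dB.
have iD := bern_integrable P mY Y01 dD.
have := Rintegral_sandwich iB iD key.
rewrite (bern_expectation mY Y01 PY indY dB (fun=> 0)).
rewrite (bern_expectation mY Y01 PY indY dD (fun=> 0)).
rewrite bern_meanD bern_mean_cst bern_meanZ (bern_mean_score_sqr isotropic).
have := bern_mean_trig q01 isotropic vM l (fun=> 0).
set b := bern_mean _ _ _ _; set I := Rintegral _ _ _ => h1 h2.
rewrite (_ : I - trig_gauss l = (I - b) + (b - trig_gauss l)); last by ring.
by apply: le_trans (ler_normD _ _) _; exact: lerD.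
Qed.

End main_estimate.

Theorem theorem5p2 (R : realType) (d : measure_display) (T : measurableType d)
  (P : probability T R) (p : nat)
  (x : nat -> 'cV[R]_p) (beta0 : 'cV[R]_p) (Y : nat -> T -> R)
  (betahat : nat -> T -> 'cV[R]_p) (Jhalf : nat -> 'M[R]_p) (n0 : nat) :
  let q := fun i => logistic (dotv beta0 (x i)) in
  let J := fun n => \sum_(i < n) (q i * (1 - q i)) *: (x i *m (x i)^T) in
  (* the responses: independent, {0,1}-valued, Pr{Y_i = 1} = q_i *)
  (forall i, measurable_fun setT (Y i)) ->
  (forall i w, Y i w = 0 \/ Y i w = 1) ->
  (forall i, P (Y i @^-1` [set 1]) = (q i)%:E) ->
  mutually_independent_rv P Y ->
  (* betahat_n is the maximum likelihood estimator (a maximiser of the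
     log-likelihood whenever one exists), measurable *)
  (forall n i j, measurable_fun setT (fun w => betahat n w i j)) ->
  (forall n w, (exists b, forall beta,
       loglik x n beta (fun i => Y i w) <= loglik x n b (fun i => Y i w)) ->
     forall beta,
       loglik x n beta (fun i => Y i w) <= loglik x n (betahat n w) (fun i => Y i w)) ->
  (* J_n invertible (for all large n), Jhalf n its symmetric square root *)
  (forall n, (n0 <= n)%N -> J n \in unitmx) ->
  (forall n, (n0 <= n)%N -> is_sym_sqrt (Jhalf n) (J n)) ->
  (* lambda_n = max_{i <= n} |J_n^{-1/2} x_i| is bounded *)
  (exists M : R, forall n i, (n0 <= n)%N -> (i < n)%N ->
      eucl_norm (invmx (Jhalf n) *m x i) <= M) ->
  (* N_n(delta) -> 0 for each delta > 0 *)
  (forall delta : R, 0 < delta ->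
     (fun n => \sum_(i < n)
        q i * (1 - q i) * ((x i)^T *m invmx (J n) *m x i) ord0 ord0
        * (if delta <= eucl_norm (invmx (Jhalf n) *m x i) then 1 else 0))
     @ \oo --> (0 : R)) ->
  (* conclusion: J_n^{1/2} (betahat_n - beta0) ->_d N_p{0, I_p} *)
  cvg_dist_std_normal P (fun n w => Jhalf n *m (betahat n w - beta0)).
Proof.
move=> q J mY Y01 PY indY _ hbeta uJ sqJ [M0 hM0] hN f cf [B0 hB0].
pose M := `|M0|; have Mge0 : 0 <= M by exact: normr_ge0.
pose B := `|B0|; have Bge0 : 0 <= B by exact: normr_ge0.
have hB u : `|f u| <= B by apply: le_trans (hB0 u) (ler_norm _).
have q01 i : 0 <= q i <= 1 by have := logistic01 (dotv beta0 (x i)); rewrite /q; lra.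
pose v n i := invmx (Jhalf n) *m x i.
have vM n i : (n0 <= n)%N -> (i < n)%N -> eucl_norm (v n i) <= M.
  by move=> nn iltn; apply: le_trans (hM0 n i nn iltn) (ler_norm _).
have iso n : (n0 <= n)%N -> forall h, \sum_(i < n) q i * (1 - q i) * dotv h (v n i) ^+ 2
    = dotv h h.
  by move=> nn h; exact: (sym_sqrt_isotropic (c := fun i => q i * (1 - q i)) (uJ n nn) (sqJ n nn)).
pose Ga n := cubic_moment n q (v n).
have Gasmall ep : 0 < ep -> \forall n \near \oo, (n0 <= n)%N /\ Ga n <= ep.
  move=> ep0.
  (* The truncation level spends half of [ep] on the small covariates, the Lindeberg-type sum the
     other half; the added 1 keeps both denominators positive when p or [M] is 0. *)
  pose de := ep / (2 * (p%:R + 1)).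
  have p1 : 0 < p%:R + 1 :> R by rewrite ltr_wpDl.
  have M1 : 0 < M + 1 by rewrite ltr_wpDl.
  have de0 : 0 < de by rewrite divr_gt0// mulr_gt0.
  have ep2 : 0 < ep / (2 * (M + 1)) by rewrite divr_gt0// mulr_gt0.
  have /cvgrPdist_le/(_ _ ep2) := hN de de0.
  move=> H; near=> n.
  have nn : (n0 <= n)%N by near: n; exact: nbhs_infty_ge.
  split => //.
  apply: le_trans (cubic_moment_le q01 (iso n nn) (vM n ^~ nn) (ltW de0) Mge0) _.
  have : `|0 - \sum_(i < n) q i * (1 - q i) * ((x i)^T *m invmx (J n) *m x i) ord0 ord0
        * (if de <= eucl_norm (invmx (Jhalf n) *m x i) then 1 else 0)|
      <= ep / (2 * (M + 1)) by near: n.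
  rewrite sub0r normrN => /(le_trans (ler_norm _)).
  have iq i : ((x i)^T *m invmx (J n) *m x i) ord0 ord0 = dotv (v n i) (v n i).
    exact: (inv_quadratic_form (c := fun i => q i * (1 - q i)) (uJ n nn) (sqJ n nn)).
  under eq_bigr do rewrite iq.
  set S := \sum_(i < n) _ => hS.
  have -> : ep = de * (p%:R + 1) + ep / (2 * (M + 1)) * (M + 1).
    by rewrite /de; field; rewrite !gt_eqF.
  apply: lerD; first by apply: ler_wpM2l; [exact: ltW|rewrite lerDl].
  apply: (@le_trans _ _ (M * (ep / (2 * (M + 1))))); first exact: ler_wpM2l.
  by rewrite mulrC; apply: ler_wpM2l; [exact: ltW|rewrite lerDl].
apply/cvgrPdist_le => e0 e00.
(* Two shares go to the Gaussian side (approximation, tail) and four to the estimator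
   (approximation, displacement, tail, Lindeberg error). *)
pose e := e0 / 6; have egt0 : 0 < e by rewrite divr_gt0.
pose m2 := normal_second_moment R; have m20 : 0 <= m2 := normal_second_moment_ge0 R.
(* [K] dominates both tail coefficients, 2 B p for the score and 2 B p m2 for the normal law. With L
   = 1 + K / e one gets K <= e L <= e L^2, which settles both tails at once. *)
pose K := 2 * B * p%:R * (1 + m2); have K0 : 0 <= K.
  by rewrite /K !mulr_ge0// addr_ge0.
pose L := 1 + K / e.
have Ke : 0 <= K / e by rewrite divr_ge0// ltW.
have L1 : 1 <= L by rewrite lerDl.
have L0 : 0 < L by exact: lt_le_trans L1.
have KL : K / L ^+ 2 <= e.
  rewrite ler_pdivrMr ?exprn_gt0//.
  have : K <= e * L by rewrite /L mulrDr mulr1 mulrC divfK ?gt_eqF// lerDr ltW.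
  move/le_trans; apply; apply: ler_wpM2l; first exact: ltW.
  by rewrite expr2 ler_peMl// ltW.
have L10 : 0 < L + 1 by rewrite addr_gt0.
have [g [[l gl] gB gf]] := trig_approx cf hB L10 egt0.
have lB u : `|trig_eval l u| <= B by rewrite -gl.
have lf (u : 'cV[R]_p) : (forall j, `|u j ord0| <= L + 1) -> `|f u - trig_eval l u| <= e.
  by rewrite -gl; exact: gf.
have [C C0 lip] : exists2 C : R, 0 <= C & forall (u w : 'cV[R]_p) (t : R), 0 <= t ->
    (forall i, `|u i ord0 - w i ord0| <= t) ->
    `|trig_eval l u - trig_eval l w| <= C * t.
  by apply: is_trig_lipschitz; exists l.
have hgauss : `|std_normal_expect f - trig_gauss l| <= e + e.
  have := @std_normal_expect_trig _ _ f l e (2 * B / L ^+ 2).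
  have H u : `|f u - trig_eval l u| <= e + 2 * B / L ^+ 2 * \sum_(j < p) u j ord0 ^+ 2.
    apply: tail_bound => //; first exact: ltW.
      by apply: le_trans (ler_normB _ _) _; have := hB u; have := lB u; lra.
    by move=> uL; apply: lf => j; apply: le_trans (uL j) _; rewrite lerDl.
  move=> /(_ H)/le_trans; apply; rewrite lerD2l; apply: le_trans KL.
  rewrite /K -!mulrA [L ^- 2 * _]mulrC !mulrA ler_pM2r ?invr_gt0 ?exprn_gt0//.
  by rewrite -/m2; apply: ler_wpM2l; [rewrite !mulr_ge0|rewrite lerDr].
have hp : 2 * B / L ^+ 2 * p%:R <= e.
  apply: le_trans KL; rewrite /K mulrAC ler_pM2r ?invr_gt0 ?exprn_gt0//.
  by rewrite ler_peMr ?mulr_ge0// lerDl.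
(* The bound 1 keeps the estimator in the enlarged cube; the bound e / (C + 1) makes the Lipschitz
   error at most [e]. *)
pose dl := Num.min 1 (e / (C + 1)).
have C1 : 0 < C + 1 by rewrite ltr_wpDl.
have dl0 : 0 < dl by rewrite lt_min ltr01 divr_gt0.
have dl1 : 0 < dl <= 1 by rewrite dl0 ge_min lexx.
have Cdl : C * dl <= e.
  apply: (@le_trans _ _ ((C + 1) * (e / (C + 1)))); last first.
    by rewrite mulrC divfK// gt_eqF.
  by apply: ler_pM => //; rewrite ?(ltW dl0) ?lerDl// ge_min lexx orbT.
pose r := p%:R * L + 1.
have r0 : 0 < r by rewrite ltr_wpDl// mulr_ge0// ltW.
pose W := trig_weight M l.
have W0 : 0 <= W.
  apply: sumr_ge0 => a _; have a0 := eucl_norm_ge0 a.1.2.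
  by rewrite mulr_ge0// addr_ge0 ?mulr_ge0.
have W1 : 0 < W + 1 by rewrite ltr_wpDl.
pose E := expR (M * r) * r ^+ 3.
have E0 : 0 < E by rewrite mulr_gt0 ?expR_gt0 ?exprn_gt0.
(* Two thresholds for the cubic moment: this one makes the localisation work, the next keeps the
   Lindeberg error below [e]. *)
have ep1 : 0 < dl ^+ 2 / 8 / E by rewrite !divr_gt0 ?exprn_gt0.
have ep2 : 0 < e / (W + 1) by rewrite divr_gt0.
near=> n.
have [nn G1] : (n0 <= n)%N /\ Ga n <= dl ^+ 2 / 8 / E by near: n; exact: Gasmall.
have [_ G2] : (n0 <= n)%N /\ Ga n <= e / (W + 1) by near: n; exact: Gasmall.
pose Z w := Jhalf n *m (betahat n w - beta0).
have Zmax w : (exists b, forall h, loglik_ratio n q (Y ^~ w) (v n) h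
      <= loglik_ratio n q (Y ^~ w) (v n) b) ->
    forall h, loglik_ratio n q (Y ^~ w) (v n) h
      <= loglik_ratio n q (Y ^~ w) (v n) (Z w).
  have uS := sym_sqrt_unit (c := fun i => q i * (1 - q i)) (uJ n nn) (sqJ n nn).
  have shift b := loglik_shift (c := fun i => q i * (1 - q i)) beta0 b (Y ^~ w)
    (uJ n nn) (sqJ n nn).
  (* Inverse of the reparametrisation beta |-> J^{1/2} (beta - beta0): existence of a maximiser and
     maximality transfer between the two forms of the likelihood. *)
  pose bb h := invmx (Jhalf n) *m h + beta0.
  have bbE h : Jhalf n *m (bb h - beta0) = h by rewrite addrK mulmxA mulmxV// mul1mx.
  move=> [b hb] h.
  have ex : exists b, forall beta,
      loglik x n beta (Y ^~ w) <= loglik x n b (Y ^~ w).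
    by exists (bb b) => beta; rewrite (shift beta) (shift (bb b)) bbE lerD2l; exact: hb.
  by have := hbeta n w ex (bb h); rewrite (shift (bb h)) (shift (betahat n w)) bbE lerD2l.
have small : expR (M * r) * cubic_moment n q (v n) * r ^+ 3 <= dl ^+ 2 / 8.
  by move: G1; rewrite ler_pdivlMr// /E mulrCA mulrA.
have := expectation_estimator_approx mY Y01 PY indY q01 (iso n nn) Mge0
  (vM n ^~ nn) Zmax L0 (ltW egt0) Bge0 dl1 Cdl hB lB lf lip small.
have GW : Ga n * W <= e.
  apply: (@le_trans _ _ (e / (W + 1) * W)); first exact: ler_wpM2r.
  by rewrite mulrAC ler_pdivrMr// ler_pM2l// lerDl.
have -> : fine 'E_P[f \o Z]%E = Rintegral P setT (f \o Z) by rewrite unlock.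
rewrite -/(Ga n) -/W => h.
rewrite (_ : std_normal_expect f - Rintegral P setT (f \o Z) =
  (std_normal_expect f - trig_gauss l) - (Rintegral P setT (f \o Z) - trig_gauss l));
  last by ring.
apply: le_trans (ler_normB _ _) _; apply: le_trans (lerD hgauss h) _.
rewrite (_ : e0 = (e + e) + (e + e + e + e)); last by rewrite /e; field.
by rewrite lerD2l; apply: lerD => //; rewrite lerD2l.
Unshelve. all: by end_near. Qed.
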